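(* Let $\phi\colon (M,g)\to (N,h)$ be a smooth harmonic map between Riemannian manifolds. Then $\phi$ is a weakly stable critical point of both $E_4$ and $E_4^{ES}$.
   Context: $\bar\nabla$ is the connection on $\phi^\ast TN$, $\tau(\phi)=\operatorname{Tr}_g\bar\nabla d\phi$ is the tension field; $\phi$ is harmonic if $\tau(\phi)=0$. $\bar\Delta=-\big(\bar\nabla_{e_i}\bar\nabla_{e_i}-\bar\nabla_{\nabla^M_{e_i}e_i}\big)$ is the rough Laplacian on sections of $\phi^\ast TN$ ($\{e_i\}$ a local orthonormal frame of $TM$, repeated indices summed), $R^N(X,Y)Z=\nabla_X\nabla_YZ-\nabla_Y\nabla_XZ-\nabla_{[X,Y]}Z$, and $$E_4(\phi)=\frac12\int_M|\bar\Delta\tau(\phi)|^2\,dv_g,\qquad E_4^{ES}(\phi)=E_4(\phi)+\frac14\int_M\sum_{i,j}|R^N(d\phi(e_i),d\phi(e_j))\tau(\phi)|^2\,dv_g .$$ A critical point $\phi$ of a functional $F\in\{E_4,E_4^{ES}\}$ is called weakly stable if $Q_F(V,V)\ge0$ for all $V\in\Gamma(\phi^\ast TN)$, $V\ne0$, where $Q_F(V,V)=\frac{d^2}{dt^2}\big|_{t=0}F(\phi_t)$ for a smooth variation $\phi_t$ of $\phi=\phi_0$ with $\partial_t\phi_t|_{t=0}=V$. Variations are taken with compact support (automatic if $M$ is closed). *)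

(* Defs.v *)
From HB Require Import structures.
From mathcomp Require Import all_boot all_order all_algebra.
From mathcomp Require Import all_classical all_reals all_analysis.

Set Implicit Arguments.
Unset Strict Implicit.
Unset Printing Implicit Defensive.

Import Order.TTheory GRing.Theory Num.Theory.
Import numFieldNormedType.Exports.

Local Open Scope classical_set_scope.
Local Open Scope ring_scope.

Definition pd (R : realType) (m : nat) (i : 'I_m) (f : 'rV[R]_m -> R)
    (x : 'rV[R]_m) : R :=
  'D_(delta_mx 0 i) f x.

(* [U] is always open in the uses of [Ck_on] and [smooth_on]. *)
Fixpoint Ck_on (R : realType) (m k : nat) (U : set 'rV[R]_m)
    (f : 'rV[R]_m -> R) : Prop :=
  (forall x, U x -> {for x, continuous f}) /\
  if k is k'.+1 then
    forall i : 'I_m,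
      (forall x, U x -> derivable f x (delta_mx 0 i)) /\ Ck_on k' U (pd i f)
  else True.

Definition smooth_on (R : realType) (m n : nat) (U : set 'rV[R]_m)
    (f : 'rV[R]_m -> 'rV[R]_n) : Prop :=
  forall (a : 'I_n) (k : nat), Ck_on k U (fun x => f x 0 a).

(* Row i holds the partial derivatives in direction i, so that tangent row
   vectors are pushed forward by v |-> v *m jac f x. *)
Definition jac (R : realType) (m n : nat) (f : 'rV[R]_m -> 'rV[R]_n)
    (x : 'rV[R]_m) : 'M[R]_(m, n) :=
  \matrix_(i, a) pd i (fun y => f y 0 a) x.

(* From here to [curv_sqnorm], G and H are the Gram matrices of the metrics of
   M and N in coordinates, and f : R^m -> R^n is the coordinate expression of a
   map M -> N. Sections of the pullback of TN and vector fields are given by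
   their components. *)

Definition inner (R : realType) (n : nat) (A : 'M[R]_n) (v w : 'rV[R]_n) : R :=
  (v *m A *m w^T) 0 0.

(* Trace of a bilinear map with respect to the inner product with Gram matrix
   A; it is the sum over an orthonormal frame by [trg_orthonormal]. *)
Definition trg (R : realType) (m : nat) (V : lmodType R) (A : 'M[R]_m)
    (B : 'I_m -> 'I_m -> V) : V :=
  \sum_i \sum_j invmx A i j *: B i j.

Lemma trg_orthonormal (R : realType) (m : nat) (V : lmodType R)
    (A E : 'M[R]_m) (B : 'I_m -> 'I_m -> V) :
  E *m A *m E^T = 1%:M ->
  trg A B = \sum_k \sum_i \sum_j (E k i * E k j) *: B i j.
Proof.
move=> EAE; have [] := mulmx1_unit EAE.
rewrite unitmx_mul => /andP[EU AU] _.
have AEE : A *m (E^T *m E) = 1%:M.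
  have EAEE : E *m (A *m (E^T *m E)) = E by rewrite !mulmxA EAE mul1mx.
  by rewrite -[LHS](mulKmx EU) EAEE mulVmx.
have iA : invmx A = E^T *m E by rewrite -[RHS](mulKmx AU) AEE mulmx1.
rewrite /trg iA [RHS]exchange_big; apply: eq_bigr => i _ /=.
rewrite [RHS]exchange_big; apply: eq_bigr => j _ /=.
by rewrite mxE scaler_suml; apply: eq_bigr => k _; rewrite mxE.
Qed.

(* christoffel G x k i j is the symbol Gamma^k_ij at x. *)
Definition christoffel (R : realType) (m : nat) (G : 'rV[R]_m -> 'M[R]_m)
    (x : 'rV[R]_m) (k i j : 'I_m) : R :=
  2^-1 * \sum_l invmx (G x) k l *
    (pd i (fun y => G y j l) x + pd j (fun y => G y i l) x
     - pd l (fun y => G y i j) x).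

Definition covd (R : realType) (n : nat) (H : 'rV[R]_n -> 'M[R]_n)
    (X Y : 'rV[R]_n -> 'rV[R]_n) (y : 'rV[R]_n) : 'rV[R]_n :=
  \row_a (\sum_b X y 0 b * pd b (fun z => Y z 0 a) y
          + \sum_b \sum_c christoffel H y a b c * X y 0 b * Y y 0 c).

Definition lie_bracket (R : realType) (n : nat)
    (X Y : 'rV[R]_n -> 'rV[R]_n) (y : 'rV[R]_n) : 'rV[R]_n :=
  \row_a \sum_b (X y 0 b * pd b (fun z => Y z 0 a) y
                 - Y y 0 b * pd b (fun z => X z 0 a) y).

Definition curv_field (R : realType) (n : nat) (H : 'rV[R]_n -> 'M[R]_n)
    (X Y Z : 'rV[R]_n -> 'rV[R]_n) (y : 'rV[R]_n) : 'rV[R]_n :=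
  covd H X (covd H Y Z) y - covd H Y (covd H X Z) y
  - covd H (lie_bracket X Y) Z y.

(* The curvature is tensorial, so the arguments may be extended by fields with
   constant components. *)
Definition curv (R : realType) (n : nat) (H : 'rV[R]_n -> 'M[R]_n)
    (y u v w : 'rV[R]_n) : 'rV[R]_n :=
  curv_field H (fun=> u) (fun=> v) (fun=> w) y.

Definition dcoord (R : realType) (m n : nat) (f : 'rV[R]_m -> 'rV[R]_n)
    (i : 'I_m) (x : 'rV[R]_m) : 'rV[R]_n :=
  row i (jac f x).

(* The pullback connection on sections along f, in the direction of the i-th
   coordinate field *)
Definition nabla (R : realType) (m n : nat) (H : 'rV[R]_n -> 'M[R]_n)
    (f : 'rV[R]_m -> 'rV[R]_n) (i : 'I_m) (W : 'rV[R]_m -> 'rV[R]_n)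
    (x : 'rV[R]_m) : 'rV[R]_n :=
  \row_a (pd i (fun y => W y 0 a) x
          + \sum_b \sum_c christoffel H (f x) a b c * dcoord f i x 0 b
                          * W x 0 c).

Definition tension (R : realType) (m n : nat) (G : 'rV[R]_m -> 'M[R]_m)
    (H : 'rV[R]_n -> 'M[R]_n) (f : 'rV[R]_m -> 'rV[R]_n)
    (x : 'rV[R]_m) : 'rV[R]_n :=
  trg (G x) (fun i j =>
    nabla H f i (dcoord f j) x
    - \sum_k christoffel G x k i j *: dcoord f k x).

Definition rough_laplacian (R : realType) (m n : nat)
    (G : 'rV[R]_m -> 'M[R]_m) (H : 'rV[R]_n -> 'M[R]_n)
    (f : 'rV[R]_m -> 'rV[R]_n) (W : 'rV[R]_m -> 'rV[R]_n)
    (x : 'rV[R]_m) : 'rV[R]_n :=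
  - trg (G x) (fun i j =>
      nabla H f i (nabla H f j W) x
      - \sum_k christoffel G x k i j *: nabla H f k W x).

(* sum_{i,j} |R(df e_i, df e_j) W|^2 over an orthonormal frame, as the trace
   over (i, k) and over (j, l) of <R(df_i, df_j) W, R(df_k, df_l) W> *)
Definition curv_sqnorm (R : realType) (m n : nat)
    (G : 'rV[R]_m -> 'M[R]_m) (H : 'rV[R]_n -> 'M[R]_n)
    (f : 'rV[R]_m -> 'rV[R]_n) (W : 'rV[R]_m -> 'rV[R]_n)
    (x : 'rV[R]_m) : R :=
  trg (V := R^o) (G x) (fun i k => trg (V := R^o) (G x) (fun j l =>
    inner (H (f x)) (curv H (f x) (dcoord f i x) (dcoord f j x) (W x))
                    (curv H (f x) (dcoord f k x) (dcoord f l x) (W x)))).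

Record chart (R : realType) (m : nat) (M : topologicalType) := Chart {
  dom : set M;
  cod : set 'rV[R]_m;
  coord : M -> 'rV[R]_m;
  param : 'rV[R]_m -> M;
  dom_open : open dom;
  cod_open : open cod;
  coord_cod : forall p, dom p -> cod (coord p);
  param_dom : forall x, cod x -> dom (param x);
  coordK : forall p, dom p -> param (coord p) = p;
  paramK : forall x, cod x -> coord (param x) = x;
  coord_continuous : forall p, dom p -> {for p, continuous coord};
  param_continuous : forall x, cod x -> {for x, continuous param} }.

(* The smooth structure is given by an atlas [chart_of], together with the
   choice [chart_at p] of a chart of the atlas around each point p. *)
Record manifold (R : realType) (m : nat) := Manifold {
  carrier :> ptopologicalType;
  manifold_hausdorff : hausdorff_space carrier;
  manifold_second_countable : @second_countable carrier;
  chart_index : Type;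
  chart_of : chart_index -> chart R m carrier;
  chart_at : carrier -> chart_index;
  mem_chart_at : forall p, dom (chart_of (chart_at p)) p;
  transition_smooth : forall c c' : chart_index,
    smooth_on (cod (chart_of c) `&` param (chart_of c) @^-1` dom (chart_of c'))
              (coord (chart_of c') \o param (chart_of c)) }.

Arguments chart_index {R m} _.
Arguments chart_of {R m} _ _.
Arguments chart_at {R m} _ _.

Definition transition (R : realType) (m : nat) (M : manifold R m)
    (c c' : chart_index M) : 'rV[R]_m -> 'rV[R]_m :=
  coord (chart_of M c') \o param (chart_of M c).

Definition overlap (R : realType) (m : nat) (M : manifold R m)
    (c c' : chart_index M) : set 'rV[R]_m :=
  cod (chart_of M c) `&` param (chart_of M c) @^-1` dom (chart_of M c').

Record riemannian (R : realType) (m : nat) := Riemannian {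
  underlying :> manifold R m;
  metric : chart_index underlying -> 'rV[R]_m -> 'M[R]_m;
  metric_smooth : forall c i,
    smooth_on (cod (chart_of underlying c)) (fun x => row i (metric c x));
  metric_sym : forall c x, cod (chart_of underlying c) x ->
    (metric c x)^T = metric c x;
  metric_pos : forall c x, cod (chart_of underlying c) x ->
    forall v : 'rV[R]_m, v != 0 -> 0 < inner (metric c x) v v;
  metric_compat : forall c c' x, overlap c c' x ->
    metric c x = jac (transition c c') x *m metric c' (transition c c' x)
                 *m (jac (transition c c') x)^T }.

Arguments metric {R m} _ _ _.

Notation borel T := (g_sigma_algebraType (@open T)).

Definition is_lebesgue (R : realType) (m : nat)
    (lam : {measure set (borel 'rV[R]_m) -> \bar R}) : Prop :=
  forall a b : 'rV[R]_m, (forall i, a 0 i <= b 0 i) ->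
    lam [set x : 'rV[R]_m | forall i, a 0 i < x 0 i < b 0 i]
    = (\prod_i (b 0 i - a 0 i))%:E.

(* dv_g = sqrt (det g_ij) dx^1 ... dx^m in every chart *)
Definition is_volume (R : realType) (m : nat) (M : riemannian R m)
    (vol : {measure set (borel M) -> \bar R}) : Prop :=
  exists2 lam : {measure set (borel 'rV[R]_m) -> \bar R}, is_lebesgue lam &
    forall (c : chart_index M) (A : set (borel M)),
      measurable A -> A `<=` dom (chart_of M c) ->
      vol A = (\int[lam]_(x in coord (chart_of M c) @` A)
                (Num.sqrt (\det (metric M c x)))%:E)%E.

Definition local_rep (R : realType) (m n : nat) (M : manifold R m)
    (N : manifold R n) (phi : M -> N) (c : chart_index M) (d : chart_index N) :
    'rV[R]_m -> 'rV[R]_n :=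
  coord (chart_of N d) \o phi \o param (chart_of M c).

Definition local_dom (R : realType) (m n : nat) (M : manifold R m)
    (N : manifold R n) (phi : M -> N) (c : chart_index M) (d : chart_index N) :
    set 'rV[R]_m :=
  cod (chart_of M c) `&` (phi \o param (chart_of M c)) @^-1` dom (chart_of N d).

Definition smooth_map (R : realType) (m n : nat) (M : manifold R m)
    (N : manifold R n) (phi : M -> N) : Prop :=
  continuous phi /\
  forall c d, smooth_on (local_dom phi c d) (local_rep phi c d).

(* Components, in the chart [chart_at N (phi p)], of the tension field at p *)
Definition tension_at (R : realType) (m n : nat) (M : riemannian R m)
    (N : riemannian R n) (phi : M -> N) (p : M) : 'rV[R]_n :=
  let c := chart_at M p in let d := chart_at N (phi p) in
  tension (metric M c) (metric N d) (local_rep phi c d)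
          (coord (chart_of M c) p).

Definition harmonic_map (R : realType) (m n : nat) (M : riemannian R m)
    (N : riemannian R n) (phi : M -> N) : Prop :=
  forall p, tension_at phi p = 0.

Definition E4_density (R : realType) (m n : nat) (M : riemannian R m)
    (N : riemannian R n) (phi : M -> N) (p : M) : R :=
  let c := chart_at M p in let d := chart_at N (phi p) in
  let G := metric M c in let H := metric N d in
  let f := local_rep phi c d in
  let x := coord (chart_of M c) p in
  let L := rough_laplacian G H f (tension G H f) x in
  inner (H (f x)) L L.

Definition ES_density (R : realType) (m n : nat) (M : riemannian R m)
    (N : riemannian R n) (phi : M -> N) (p : M) : R :=
  let c := chart_at M p in let d := chart_at N (phi p) in
  let G := metric M c in let H := metric N d in
  let f := local_rep phi c d in
  curv_sqnorm G H f (tension G H f) (coord (chart_of M c) p).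

Definition E4 (R : realType) (m n : nat) (M : riemannian R m)
    (N : riemannian R n) (vol : {measure set (borel M) -> \bar R})
    (phi : M -> N) : \bar R :=
  ((2^-1 : R)%:E * \int[vol]_p (E4_density phi p)%:E)%E.

Definition E4ES (R : realType) (m n : nat) (M : riemannian R m)
    (N : riemannian R n) (vol : {measure set (borel M) -> \bar R})
    (phi : M -> N) : \bar R :=
  (E4 vol phi + (4^-1 : R)%:E * \int[vol]_p (ES_density phi p)%:E)%E.

(* [Phi] is smooth on ]-e, e[ x M; the first coordinate of z is the time. *)
Record is_variation (R : realType) (m n : nat) (M : manifold R m)
    (N : manifold R n) (phi : M -> N) (e : R) (Phi : R -> M -> N) : Prop :=
  IsVariation {
  variation_pos : 0 < e;
  variation_0 : Phi 0 = phi;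
  variation_continuous : forall (t : R) (p : M), `|t| < e ->
    {for (t, p), continuous (fun q : R * M => Phi q.1 q.2)};
  variation_smooth : forall c d,
    smooth_on
      [set z : 'rV[R]_(1 + m) | `|lsubmx z 0 0| < e /\
         local_dom (Phi (lsubmx z 0 0)) c d (rsubmx z)]
      (fun z => local_rep (Phi (lsubmx z 0 0)) c d (rsubmx z));
  variation_support : exists2 K : set M, compact K &
    forall (t : R) (p : M), `|t| < e -> ~ K p -> Phi t p = phi p }.

(* A section of the pullback of TN along phi: [V p d] is the row of components
   of the vector at p in the chart d of N, meaningful when phi p lies in the
   domain of d. *)
Record is_section (R : realType) (m n : nat) (M : manifold R m)
    (N : manifold R n) (phi : M -> N)
    (V : M -> chart_index N -> 'rV[R]_n) : Prop :=
  IsSection {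
  section_compat : forall p d d',
    dom (chart_of N d) (phi p) -> dom (chart_of N d') (phi p) ->
    V p d' = V p d *m jac (transition d d') (coord (chart_of N d) (phi p));
  section_smooth : forall c d,
    smooth_on (local_dom phi c d) (fun x => V (param (chart_of M c) x) d) }.

Definition section_neq0 (R : realType) (m n : nat) (M : manifold R m)
    (N : manifold R n) (phi : M -> N)
    (V : M -> chart_index N -> 'rV[R]_n) : Prop :=
  exists p d, dom (chart_of N d) (phi p) /\ V p d != 0.

Definition is_velocity (R : realType) (m n : nat) (M : manifold R m)
    (N : manifold R n) (phi : M -> N) (Phi : R -> M -> N)
    (V : M -> chart_index N -> 'rV[R]_n) : Prop :=
  forall p d, dom (chart_of N d) (phi p) ->
    is_derive (0 : R) (1 : R) (fun t => coord (chart_of N d) (Phi t p)) (V p d).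

Definition functional_along (R : realType) (M N : Type)
    (F : (M -> N) -> \bar R) (Phi : R -> M -> N) (t : R) : R :=
  fine (F (Phi t)).

(* 'D_v f and [fine] are total functions with default values, so finiteness of
   the functional near t = 0 and existence of the derivatives are stated. *)
Definition critical_point (R : realType) (m n : nat) (M : manifold R m)
    (N : manifold R n) (F : (M -> N) -> \bar R) (phi : M -> N) : Prop :=
  forall (e : R) (Phi : R -> M -> N), is_variation phi e Phi ->
    (\forall t \near (0 : R), F (Phi t) \is a fin_num) /\
    is_derive (0 : R) (1 : R) (functional_along F Phi) (0 : R).

Definition is_second_derivative (R : realType) (f : R -> R) (q : R) : Prop :=
  (\forall t \near (0 : R), derivable f t 1) /\
  is_derive (0 : R) (1 : R) (fun t => 'D_1 f t) q.

Definition weakly_stable (R : realType) (m n : nat) (M : manifold R m)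
    (N : manifold R n) (F : (M -> N) -> \bar R) (phi : M -> N) : Prop :=
  forall V : M -> chart_index N -> 'rV[R]_n,
    is_section phi V -> section_neq0 phi V ->
    forall (e : R) (Phi : R -> M -> N),
      is_variation phi e Phi -> is_velocity phi Phi V ->
      (\forall t \near (0 : R), F (Phi t) \is a fin_num) /\
      exists2 q : R, is_second_derivative (functional_along F Phi) q & 0 <= q.

(* Main.v *)
From HB Require Import structures.
Require Import Defs.
From mathcomp Require Import all_boot all_order all_algebra.
From mathcomp Require Import all_classical all_reals all_analysis.
From mathcomp Require Import measurable_realfun.
From mathcomp Require Import ring lra.

(** Both functionals are integrals of densities that are nonnegative and that
    vanish on every open set on which the tension field vanishes. Hence along a
    variation [Phi] of a harmonic map the function [t |-> F (Phi t)] is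
    nonnegative and vanishes at 0. Once it is known to be twice differentiable,
    its first derivative at 0 is 0 and its second derivative at 0 is nonnegative
    ([derive_at_minimum], [second_derivative_at_minimum]); no formula for the
    second variation is required. So the content of the proof is regularity in
    [t] of the integrals, and it has the following ingredients.

    The density at [p] is computed in charts attached to [p] and to [Phi t p],
    and the second one jumps with [t]. The densities have therefore to be shown
    independent of the charts. This comes down to one identity,
    [gamma_isometry]: if [th] pulls [G'] back to [G], then the symbols of [G]
    satisfy Gamma^k_ij d_k th = nabla_i d_j th, the covariant derivative being
    that of [G'] along [th]. It yields the behaviour of [nabla] and of traces of
    covariant derivatives ([covdiv]) under changes of coordinates in the target
    ([nabla_target], [covdiv_target]) and in the source ([nabla_source],
    [covdiv_source]), thus that of the tension field and of the rough Laplacian.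
    For the curvature term no separate transformation law is proved:
    [curv_commutator] identifies it with a commutator of covariant derivatives
    along the map, to which the same lemmas apply. Its nonnegativity,
    [trg2_inner_ge0], is seen in an orthonormal frame of the source.

    In fixed charts the density of [Phi t] at the point of coordinates [x] is a
    smooth function of [(t, x)], because a spatial derivative of a time slice
    is a partial derivative on space-time ([nabla_slice]). With chart
    independence this shows that the density is a [smooth_family]
    ([smooth_family_dens]). Such families are stable under d/dt and continuous in
    time and position, hence bounded near [t = 0] on compact sets.

    Outside the compact support of the variation the density is that of the
    harmonic map, that is 0 ([dens_local], [dens_harmonic]). Compact sets have
    finite volume ([compact_finite_volume]), so the integral can be
    differentiated twice under the integral sign ([twice_derivable_integral]).

    Smoothness is a statement about iterated partial derivatives, so the
    calculus behind these arguments is built first: continuous partial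
    derivatives imply differentiability ([C1_differentiable]), the chain rule
    ([pd_comp]), symmetry of second derivatives ([schwarz]) and closure of C^k
    functions under the algebraic operations and composition. *)

Set Implicit Arguments.
Unset Strict Implicit.
Unset Printing Implicit Defensive.

Import Order.TTheory GRing.Theory Num.Theory.
Import numFieldNormedType.Exports.

Local Open Scope classical_set_scope.
Local Open Scope ring_scope.

(** * Differentiability of functions with continuous partial derivatives *)

Section PartialDerivatives.
Context {R : realType}.
Implicit Types m n k : nat.

Lemma near_open (T : topologicalType) (U : set T) x :
  open U -> U x -> \forall y \near x, U y.
Proof. by move=> oU Ux; apply: open_nbhs_nbhs. Qed.

Lemma derivable_line (V W : normedModType R) (f : V -> W) (x w : V) :
  derivable f x w -> is_derive (0 : R) (1 : R) (fun u : R => f (u *: w + x)) ('D_w f x).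
Proof.
move=> df; have dg := iffLR (derivable1P f x w) df.
apply: DeriveDef => //.
rewrite /derive; set g1 := fun h => h^-1 *: _; set g2 := fun h => h^-1 *: _.
suff -> : g1 = g2 by [].
by apply/funext => u; rewrite /g1 /g2 /= scale0r add0r addr0 [_%:A]mulr1.
Qed.

(** The mean value theorem on the segment from [x] to [x + h *: w]; [h] may have
    any sign, which is why the intermediate point is given by [s] in [0, 1]. *)
Lemma mvt_line (V : normedModType R) (f : V -> R) (x w : V) (h : R) :
  (forall s : R, 0 <= s <= 1 -> derivable f (x + (s * h) *: w) w) ->
  exists2 s : R, 0 <= s <= 1 &
    f (x + h *: w) - f x = h * 'D_w f (x + (s * h) *: w).
Proof.
move=> df; pose g s : R := f (x + (s * h) *: w).
have dg (s : R) : 0 <= s <= 1 ->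
    is_derive s 1 g (h * 'D_w f (x + (s * h) *: w)).
  move=> s01; set y := x + _.
  pose a u := f (u *: w + y); pose b (u : R) : R := (u - s) * h.
  have gE : g = a \o b.
    apply/funext => u; rewrite /g /a /b /y /=; congr (f _).
    by rewrite addrCA -scalerDl; congr (_ + _ *: _); ring.
  have da : is_derive (b s) 1 a ('D_w f y).
    by rewrite /b subrr mul0r; exact: derivable_line (df _ s01).
  have db : is_derive s 1 b h.
    by rewrite /b; apply: is_derive_eq; rewrite /GRing.scale /=; ring.
  by rewrite gE mulrC; exact: is_derive1_comp.
have [|||s s01] := @MVT_segment _ g (fun s => h * 'D_w f (x + (s * h) *: w)) 0 1.
- exact: ler01.
- by move=> s; rewrite in_itv/= => /andP[s0 s1]; apply: dg; rewrite !ltW.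
- by apply: derivable_within_continuous => s; rewrite in_itv/= => /dg[].
rewrite /g subr0 mulr1 mul1r mul0r scale0r addr0 => fE.
by exists s => //; rewrite in_itv/= in s01.
Qed.

(** Used to move from 0 to [v] one coordinate at a time. *)
Definition row_trunc n (k : nat) (v : 'rV[R]_n) : 'rV[R]_n :=
  \row_b (if (b < k)%N then v 0 b else 0).

Lemma norm_coord n (v : 'rV[R]_n) i : `|v 0 i| <= `|v|.
Proof.
by rewrite [leRHS]/Num.Def.normr/= mx_normrE (le_bigmax _ _ (ord0, i)).
Qed.

Lemma norm_row_le n (v : 'rV[R]_n) (a : R) :
  0 <= a -> (forall i, `|v 0 i| <= a) -> `|v| <= a.
Proof.
move=> a0 va; rewrite [leLHS]/Num.Def.normr/= mx_normrE bigmax_le// => -[i j] _.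
by rewrite /= [i]ord1.
Qed.

Lemma row_truncS n (v : 'rV[R]_n) (i : 'I_n) :
  row_trunc i.+1 v = row_trunc i v + v 0 i *: delta_mx 0 i.
Proof.
apply/rowP => b; rewrite !mxE eqxx /= ltnS leq_eqVlt -val_eqE.
by case: ltngtP => [||/val_inj ->]; rewrite ?mulr0 ?mulr1 ?addr0 ?add0r.
Qed.

Lemma continuous_sum (T : topologicalType) (I : Type) (r : seq I) (P : pred I)
    (f : I -> T -> R) (x : T) :
  (forall i, P i -> {for x, continuous (f i)}) ->
  {for x, continuous (fun y => \sum_(i <- r | P i) f i y)}.
Proof.
move=> fc; elim: r => [|i r IH].
  have -> : (fun y => \sum_(i <- [::] | P i) f i y) = cst 0.
    by apply/funext => y; rewrite big_nil.
  exact: cvg_cst.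
have [Pi|nPi] := boolP (P i); last first.
  have -> // : (fun y => \sum_(i <- i :: r | P i) f i y) =
               (fun y => \sum_(i <- r | P i) f i y).
  by apply/funext => y; rewrite big_cons (negbTE nPi).
have -> : (fun y => \sum_(i <- i :: r | P i) f i y) =
             f i \+ (fun y => \sum_(i <- r | P i) f i y).
  by apply/funext => y; rewrite big_cons Pi.
exact: (continuousD (fc i Pi) IH).
Qed.

Lemma continuous_mulmx_entry n (A : 'cV[R]_n) :
  continuous (fun v : 'rV[R]_n => (v *m A) 0 0 : R).
Proof.
move=> v; have -> : (fun v : 'rV[R]_n => (v *m A) 0 0) =
    (fun v => \sum_i (v 0 i * A i 0)).
  by apply/funext => u; rewrite mxE.
apply: continuous_sum => i _; apply: (@continuousM R _ (fun u : 'rV[R]_n => u 0 i) (cst (A i 0)) v).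
  exact: coord_continuous.
exact: cst_continuous.
Qed.

(** The differential is defined by choice among linear maps, so a first-order
    expansion has to be turned into differentiability explicitly. *)
Lemma differentiable_littleo (V W : normedModType R) (f : V -> W)
    (df : {linear V -> W}) (x : V) :
  continuous df ->
  (forall e : R, 0 < e ->
     \forall y \near x, `|f y - f x - df (y - x)| <= e * `|y - x|) ->
  differentiable f x.
Proof.
move=> dfc dxf; apply/diffP.
apply: (@getPex _ (fun (df : {linear V -> W}) => continuous df /\
  forall y, f y = f (lim (nbhs x)) + df (y - lim (nbhs x))
                  +o_(y \near x) (y - lim (nbhs x)))).
exists df; split=> //; rewrite lim_id //.
suff : f = (cst (f x) + (df \o center x)) +o_ (nbhs x) (center x) by rewrite funeqE.
apply/eqaddoP => e e0; near=> y.
suff : `|f y - f x - df (y - x)| <= e * `|y - x|.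
  by rewrite -addrA -opprD.
by near: y; exact: dxf.
Unshelve. all: by end_near. Qed.

(** The increment of [f] is the sum of its increments along the coordinate
    directions; each is, by the mean value theorem, a partial derivative at a
    point near [x] times the coordinate of the increment. *)
Lemma C1_differentiable n (f : 'rV[R]_n -> R) (x : 'rV[R]_n) :
  (\forall y \near x, forall i : 'I_n, derivable f y (delta_mx 0 i)) ->
  (forall i, {for x, continuous (pd i f)}) -> differentiable f x.
Proof.
move=> df cf; pose D : 'cV[R]_n := \col_i pd i f x.
pose L (v : 'rV[R]_n) : R^o := (v *m D) 0 0.
have Llin : linear L.
  by move=> a u v; rewrite /L mulmxDl -scalemxAl !mxE.
pose LM := GRing.isLinear.Build _ _ _ _ _ Llin.
pose LL : {linear 'rV[R]_n -> R^o} := HB.pack L LM.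
apply: (@differentiable_littleo _ R^o f LL); first exact: continuous_mulmx_entry.
(* Each of the n coordinates contributes an error of at most e / n.+1 times the
   norm of the increment. *)
move=> e e0; pose e' := e / n.+1%:R.
have e'0 : 0 < e' by rewrite divr_gt0.
have : \forall y \near x, (forall i : 'I_n, derivable f y (delta_mx 0 i)) /\
    (forall i : 'I_n, `|pd i f x - pd i f y| <= e').
  near=> y; split; first by near: y.
  near: y; apply: filter_forall => i.
  by have /cvgrPdist_le/(_ _ e'0) := cf i.
move=> /nbhs_normP[r /= r0 rP].
have xr : \forall y \near x, `|x - y| < r.
  by have := nbhsx_ballx x r r0; rewrite -ball_normE.
near=> y.
have {}rP z : `|x - z| <= `|x - y| -> (forall i : 'I_n, derivable f z (delta_mx 0 i)) /\
    (forall i : 'I_n, `|pd i f x - pd i f z| <= e').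
  move=> zy; apply: rP => /=; apply: le_lt_trans zy _.
  by near: y.
have [v vE] : exists v, v = y - x by exists (y - x).
have step (k : nat) : (k <= n)%N ->
  `|f (x + row_trunc k v) - f x - \sum_(b < n | (b < k)%N) v 0 b * pd b f x|
    <= k%:R * e' * `|v|.
  elim: k => [_|k IH kn].
    have -> : row_trunc 0 v = 0 by apply/rowP => b; rewrite !mxE.
    by rewrite big_pred0 // addr0 !subrr normr0 !mul0r.
  pose i := Ordinal kn.
  have inball (s : R) : 0 <= s <= 1 ->
      `|x - (x + row_trunc i v + (s * v 0 i) *: delta_mx 0 i)| <= `|x - y|.
    move=> /andP[s0 s1].
    rewrite -addrA opprD addNKr normrN [leRHS]distrC -vE.
    apply: norm_row_le => // b; rewrite !mxE eqxx /=.
    rewrite -val_eqE /=; case: ltngtP => [bk|bk|bk].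
    - by rewrite mulr0 addr0 norm_coord.
    - by rewrite mulr0 addr0 normr0.
    rewrite mulr1 add0r normrM ger0_norm //.
    by rewrite (le_trans _ (norm_coord v i)) // ler_piMl.
  have [s /inball/rP[_ sP] sE] := @mvt_line _ f (x + row_trunc i v) (delta_mx 0 i) (v 0 i)
    (fun s sP => (rP _ (inball s sP)).1 i).
  rewrite (@row_truncS _ v i) addrA (bigD1 i) //=.
  under eq_bigl => b do rewrite ltnS -val_eqE /= andbC -ltn_neqAle.
  rewrite -(subrK (f (x + row_trunc i v)) (f (_ + _ *: _))) sE /=.
  set P := 'D_ _ f _; set F := f (x + row_trunc k v); set S := \sum_(_ < n | _) _.
  have -> : v 0 i * P + F - f x - (v 0 i * pd i f x + S) =
            (F - f x - S) + v 0 i * (P - pd i f x) by ring.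
  rewrite (le_trans (ler_normD _ _)) // -natr1 mulrDl mul1r mulrDl lerD ?IH ?(ltnW kn) //.
  rewrite normrM mulrC ler_pM ?norm_coord // distrC; exact: sP.
have := step n (leqnn n).
have -> : row_trunc n v = v by apply/rowP => b; rewrite !mxE ltn_ord.
rewrite vE (addrC x) subrK /LL /= /L mxE.
under eq_bigl => b do rewrite ltn_ord.
under [X in _ -> `|_ - X| <= _]eq_bigr => b do rewrite [D b 0]mxE.
move=> /le_trans; apply.
rewrite ler_wpM2r // /e' mulrCA ler_piMr //; first exact: ltW.
by rewrite ler_pdivrMr // mul1r ler_nat.
Unshelve. all: by end_near. Qed.

Lemma derive_chain (V : normedModType R) n (g : 'rV[R]_n -> R)
    (f : V -> 'rV[R]_n) (x w : V) :
  differentiable g (f x) -> derivable f x w ->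
  is_derive x w (g \o f) (\sum_b 'D_w f x 0 b * pd b g (f x)).
Proof.
move=> dg df; have da := derivable_line df.
pose a (u : R) := f (u *: w + x).
have a0 : a 0 = f x by rewrite /a scale0r add0r.
have dfa : differentiable a (0 : R).
  exact: (iffLR (derivable1_diffP a 0) (@ex_derive _ _ _ _ _ _ _ da)).
have dga : differentiable g (a 0) by rewrite a0.
have dgoa : differentiable (g \o a) (0 : R) by exact: differentiable_comp.
have dgf : derivable (g \o f) x w.
  exact: (iffRL (derivable1P (g \o f) x w) (iffRL (derivable1_diffP (g \o a) 0) dgoa)).
apply: DeriveDef => //.
have -> : 'D_w (g \o f) x = 'D_(1 : R) (g \o a) (0 : R).
  by apply: esym; exact: (@derive_val _ _ _ _ _ _ _ (derivable_line dgf)).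
have aD : 'D_(1 : R) a (0 : R) = 'D_w f x by exact: (@derive_val _ _ _ _ _ _ _ da).
rewrite deriveE // diff_comp //= -(deriveE _ dfa) aD a0.
rewrite [in LHS](row_sum_delta ('D_w f x)) linear_sum.
apply: eq_bigr => b _; rewrite linearZ /= /pd -deriveE //.
Qed.

End PartialDerivatives.

(** * Symmetry of second partial derivatives *)

Section Schwarz.
Context {R : realType}.

Lemma derivable_translate (V W : normedModType R) (f : V -> W) (c x w : V) :
  derivable f (x + c) w -> is_derive x w (fun y => f (y + c)) ('D_w f (x + c)).
Proof.
rewrite /derivable /derive => df.
suff E : (fun h : R => h^-1 *: (((fun y => f (y + c)) \o shift x) (h *: w) - f (x + c)))
   = (fun h : R => h^-1 *: ((f \o shift (x + c)) (h *: w) - f (x + c))).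
  by apply: DeriveDef; rewrite /derivable /derive E.
by apply/funext => h /=; rewrite addrA.
Qed.

(** Applying the mean value theorem first in direction [i], to the increment of
    [f] in direction [j], then in direction [j]. The left-hand side is symmetric
    in [i] and [j]. *)
Lemma second_difference m (f : 'rV[R]_m -> R) (x : 'rV[R]_m) (i j : 'I_m) (h : R) :
  (forall s t : R, 0 <= s <= 1 -> 0 <= t <= 1 ->
     derivable f (x + (s * h) *: delta_mx 0 i + (t * h) *: delta_mx 0 j)
       (delta_mx 0 i) /\
     derivable (pd i f) (x + (s * h) *: delta_mx 0 i + (t * h) *: delta_mx 0 j)
       (delta_mx 0 j)) ->
  exists s t : R, [/\ 0 <= s <= 1, 0 <= t <= 1 &
    f (x + h *: delta_mx 0 i + h *: delta_mx 0 j) - f (x + h *: delta_mx 0 i)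
    - (f (x + h *: delta_mx 0 j) - f x) =
    h * (h * pd j (pd i f)
      (x + (s * h) *: delta_mx 0 i + (t * h) *: delta_mx 0 j))].
Proof.
move=> df; set ei : 'rV[R]_m := delta_mx 0 i; set ej : 'rV[R]_m := delta_mx 0 j.
have i0 : 0 <= (0 : R) <= 1 by rewrite lexx ler01.
have i1 : 0 <= (1 : R) <= 1 by rewrite lexx ler01.
pose g y := f (y + h *: ej) - f y.
have dg (s : R) : 0 <= s <= 1 -> is_derive (x + (s * h) *: ei) ei g
    (pd i f (x + (s * h) *: ei + h *: ej) - pd i f (x + (s * h) *: ei)).
  move=> s01.
  have [d1 _] := df s 1 s01 i1; have [d0 _] := df s 0 s01 i0.
  rewrite mul1r in d1; rewrite mul0r scale0r addr0 in d0.
  have D1 := derivable_translate d1; have D0 := derivableP d0.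
  exact: is_deriveB.
have [s s01 gE] := mvt_line (fun s s01 => @ex_derive _ _ _ _ _ _ _ (dg s s01)).
have [t t01 fE] := @mvt_line R _ (pd i f) (x + (s * h) *: ei) ej h
  (fun t t01 => (df s t s01 t01).2).
exists s, t; split => //.
by rewrite -[LHS]/(g (x + h *: ei) - g x) gE (@derive_val _ _ _ _ _ _ _ (dg s s01)) fE.
Qed.

Lemma norm_delta_le m (i : 'I_m) : `|delta_mx 0 i : 'rV[R]_m| <= 1.
Proof.
apply: norm_row_le => // j; rewrite mxE eqxx /=.
by case: (_ == _); rewrite ?normr1 ?normr0.
Qed.

(** The symmetric second difference, divided by h^2, is a value of each of the
    two mixed derivatives near [x]; continuity makes them equal at [x]. *)
Theorem schwarz m (U : set 'rV[R]_m) (f : 'rV[R]_m -> R) (x : 'rV[R]_m)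
    (i j : 'I_m) :
  open U -> Ck_on 2 U f -> U x -> pd j (pd i f) x = pd i (pd j f) x.
Proof.
move=> oU [_ f2] Ux.
wlog suff: / ~ (0 < `|pd j (pd i f) x - pd i (pd j f) x|).
  by move=> /negP; rewrite normr_gt0 negbK subr_eq0 => /eqP.
set d := `|_| => d0.
have d20 : 0 < d / 2 by rewrite divr_gt0.
have cont a b : {for x, continuous (pd b (pd a f))}.
  by have [_ [_ /(_ b) [_ [cab _]]]] := f2 a; exact: cab.
have c1 := iffLR (cvgrPdist_lt _ _) (cont i j) _ d20.
have c2 := iffLR (cvgrPdist_lt _ _) (cont j i) _ d20.
have c3 := near_open oU Ux.
have : \forall y \near x, [/\ U y, `|pd j (pd i f) x - pd j (pd i f) y| < d / 2 &
    `|pd i (pd j f) x - pd i (pd j f) y| < d / 2].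
  exact: (@filterS3 _ (nbhs x) _ _ _ _ _ (fun y a b c => And3 a b c) c3 (c1 _) (c2 _)).
(* The intermediate points are at distance at most 2 h from x. *)
move=> /nbhs_normP[r /= r0 rP]; pose h := r / 3.
have h0 : 0 < h by rewrite divr_gt0.
have near_x (a b : 'I_m) (s t : R) : 0 <= s <= 1 -> 0 <= t <= 1 ->
  `|x - (x + (s * h) *: delta_mx 0 a + (t * h) *: delta_mx 0 b)| < r.
  move=> /andP[s0 s1] /andP[t0 t1].
  rewrite -addrA opprD addNKr normrN.
  have le1 (u : R) (c : 'I_m) : 0 <= u -> u <= 1 ->
      `|(u * h) *: delta_mx 0 c : 'rV[R]_m| <= h.
    move=> u0 u1; have uh : `|u * h| <= h.
      have uh0 : 0 <= u * h by rewrite mulr_ge0 // ltW.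
      by rewrite (ger0_norm uh0); apply: ler_piMl => //; exact: ltW.
    by rewrite normrZ -[leRHS]mulr1 ler_pM // norm_delta_le.
  rewrite (le_lt_trans (ler_normD _ _)) //.
  rewrite (le_lt_trans (lerD (le1 _ _ s0 s1) (le1 _ _ t0 t1))) //.
  by rewrite /h; lra.
have der (a b : 'I_m) y : U y ->
    derivable f y (delta_mx 0 a) /\ derivable (pd a f) y (delta_mx 0 b).
  by move=> Uy; have [da [_ /(_ b) [dab _]]] := f2 a; split; [exact: da|exact: dab].
have Ubox (a b : 'I_m) (s t : R) : 0 <= s <= 1 -> 0 <= t <= 1 ->
    U (x + (s * h) *: delta_mx 0 a + (t * h) *: delta_mx 0 b).
  by move=> s01 t01; have [] := rP _ (near_x a b s t s01 t01).
have [s [t [s01 t01 st]]] := second_difference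
  (fun s t s01 t01 => der i j _ (Ubox i j s t s01 t01)).
have [s' [t' [s'01 t'01 st']]] := second_difference
  (fun s t s01 t01 => der j i _ (Ubox j i s t s01 t01)).
have [_ P1 _] := rP _ (near_x i j s t s01 t01).
have [_ _ P2] := rP _ (near_x j i s' t' s'01 t'01).
move: P1 P2 st st'; rewrite (addrAC x (h *: delta_mx 0 i)).
move: (pd j (pd i f) (_ + _)) (pd i (pd j f) (_ + _)) => A B.
move: (f (x + _ + _)) (f (x + _)) (f (x + _)) => F1 F2 F3 P1 P2 st st'.
have : h * (h * A) = h * (h * B) by rewrite -st -st'; ring.
have hn0 : h != 0 by rewrite gt_eqF.
move=> /(mulfI hn0)/(mulfI hn0) AB.
suff : d < d by rewrite ltxx.
rewrite [ltRHS](splitr d) {1}/d -(subrK A (pd j (pd i f) x)) -addrA {2}AB.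
by rewrite (le_lt_trans (ler_normD _ _)) // ltrD // distrC.
Qed.

End Schwarz.

(** * Calculus of C^k functions *)

Section CkFunctions.
Context {R : realType}.
Implicit Types m n k : nat.

Lemma Ck_continuous m k (U : set 'rV[R]_m) f x :
  Ck_on k U f -> U x -> {for x, continuous f}.
Proof. by case: k => [|k] [cf _] Ux; exact: cf. Qed.

Lemma Ck_derivable m k (U : set 'rV[R]_m) f (i : 'I_m) x :
  Ck_on k.+1 U f -> U x -> derivable f x (delta_mx 0 i).
Proof. by move=> [_ /(_ i) [df _]] Ux; exact: df. Qed.

Lemma Ck_pd m k (U : set 'rV[R]_m) f (i : 'I_m) :
  Ck_on k.+1 U f -> Ck_on k U (pd i f).
Proof. by move=> [_ /(_ i) []]. Qed.

Lemma CkS m k (U : set 'rV[R]_m) f : Ck_on k.+1 U f -> Ck_on k U f.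
Proof.
elim: k f => [|k IH] f /= [cf df]; split=> // i.
by have [dfi /IH] := df i.
Qed.

Lemma near_eq_open m (U : set 'rV[R]_m) (T : Type) (f g : 'rV[R]_m -> T) x :
  open U -> (forall y, U y -> f y = g y) -> U x -> \forall y \near x, f y = g y.
Proof. by move=> oU fg Ux; apply: filterS (near_open oU Ux) => y /fg. Qed.

Lemma pd_eq m (U : set 'rV[R]_m) f g (i : 'I_m) x :
  open U -> (forall y, U y -> f y = g y) -> U x -> pd i f x = pd i g x.
Proof. by move=> oU fg Ux; exact: near_eq_derive (near_eq_open oU fg Ux). Qed.

Lemma continuous_near_eq (S T : topologicalType) (f g : S -> T) x :
  (\forall y \near x, f y = g y) -> {for x, continuous f} ->
  {for x, continuous g}.
Proof.
move=> fg cf; rewrite /prop_for /continuous_at -(nbhs_singleton fg).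
by apply: cvg_trans cf; exact: near_eq_cvg.
Qed.

Lemma Ck_eq m k (U : set 'rV[R]_m) f g :
  open U -> (forall y, U y -> f y = g y) -> Ck_on k U f -> Ck_on k U g.
Proof.
move=> oU; elim: k f g => [|k IH] f g fg [cf df]; split => //.
- by move=> x Ux; exact: continuous_near_eq (near_eq_open oU fg Ux) (cf x Ux).
- by move=> x Ux; exact: continuous_near_eq (near_eq_open oU fg Ux) (cf x Ux).
move=> i; have [dfi Cfi] := df i; split.
  by move=> x Ux; exact: near_eq_derivable (near_eq_open oU fg Ux) (dfi x Ux).
by apply: IH Cfi => y Uy; exact: pd_eq oU fg Uy.
Qed.

Lemma Ck_sub m k (U V : set 'rV[R]_m) f :
  V `<=` U -> Ck_on k U f -> Ck_on k V f.
Proof.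
move=> VU; elim: k f => [|k IH] f [cf df]; split => //.
- by move=> x /VU; exact: cf.
- by move=> x /VU; exact: cf.
by move=> i; have [dfi /IH] := df i; split => // x /VU; exact: dfi.
Qed.

Lemma Ck_cst m k (U : set 'rV[R]_m) (a : R) : Ck_on k U (fun=> a).
Proof.
elim: k a => [|k IH] a; split => //; try by move=> x _; exact: cst_continuous.
move=> i; split; first by move=> x _; exact: derivable_cst.
suff -> : pd i (fun=> a) = fun=> 0 by exact: IH.
by apply/funext => x; exact: derive_cst.
Qed.

Lemma is_derive_coord m n (i : 'I_m) (j : 'I_n) (x w : 'M[R]_(m, n)) :
  is_derive x w (fun y : 'M[R]_(m, n) => y i j) (w i j).
Proof.
have id_mx := @derivable_id R 'M[R]_(m, n) x w.
apply: DeriveDef; first exact: (iffLR (derivable_mxP _ _ _) id_mx).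
by have := derive_mx id_mx; rewrite derive_id => {2}->; rewrite mxE.
Qed.

Lemma Ck_coord m k (U : set 'rV[R]_m) (j : 'I_m) :
  Ck_on k U (fun x => x 0 j).
Proof.
have cont (x : 'rV[R]_m) : {for x, continuous (fun y : 'rV[R]_m => y 0 j)}.
  exact: coord_continuous.
case: k => [|k]; split => // i; split.
  by move=> x _; exact: (@ex_derive _ _ _ _ _ _ _ (is_derive_coord 0 j x _)).
have -> : pd i (fun x : 'rV[R]_m => x 0 j) = fun=> (delta_mx 0 i : 'rV[R]_m) 0 j.
  by apply/funext => x; exact: (@derive_val _ _ _ _ _ _ _ (is_derive_coord 0 j x _)).
exact: Ck_cst.
Qed.

Lemma Ck_add m k (U : set 'rV[R]_m) f g :
  open U -> Ck_on k U f -> Ck_on k U g -> Ck_on k U (fun x => f x + g x).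
Proof.
move=> oU; elim: k f g => [|k IH] f g [cf df] [cg dg]; split => //;
  try by move=> x Ux; apply: (continuousD (cf x Ux) (cg x Ux)).
move=> i; have [dfi Cfi] := df i; have [dgi Cgi] := dg i; split.
  by move=> x Ux; exact: derivableD (dfi x Ux) (dgi x Ux).
apply: Ck_eq (IH _ _ Cfi Cgi) => // y Uy.
by rewrite /pd -(deriveD (dfi y Uy) (dgi y Uy)).
Qed.

Lemma Ck_sum m k (U : set 'rV[R]_m) (I : Type) (r : seq I) (P : pred I)
    (f : I -> 'rV[R]_m -> R) :
  open U -> (forall i, P i -> Ck_on k U (f i)) ->
  Ck_on k U (fun x => \sum_(i <- r | P i) f i x).
Proof.
move=> oU Cf; elim: r => [|i r IH].
  by apply: Ck_eq (Ck_cst k U 0) => // x _; rewrite big_nil.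
have [Pi|nPi] := boolP (P i); last first.
  by apply: Ck_eq IH => // x _; rewrite big_cons (negbTE nPi).
by apply: Ck_eq (Ck_add oU (Cf i Pi) IH) => // x _; rewrite big_cons Pi.
Qed.

Lemma pdM m (f g : 'rV[R]_m -> R) (i : 'I_m) x :
  derivable f x (delta_mx 0 i) -> derivable g x (delta_mx 0 i) ->
  pd i (fun y => f y * g y) x = pd i f x * g x + f x * pd i g x.
Proof.
by move=> df dg; rewrite /pd [LHS](deriveM df dg) /GRing.scale /= addrC mulrC.
Qed.

Lemma Ck_mul m k (U : set 'rV[R]_m) f g :
  open U -> Ck_on k U f -> Ck_on k U g -> Ck_on k U (fun x => f x * g x).
Proof.
move=> oU; elim: k f g => [|k IH] f g Cf Cg; split => //;
  try by move=> x Ux; apply: (continuousM (Ck_continuous Cf Ux) (Ck_continuous Cg Ux)).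
move=> i; split.
  by move=> x Ux; have := @derivableM _ _ f g x _ (Ck_derivable Cf Ux) (Ck_derivable Cg Ux); exact.
have C1 := IH _ _ (Ck_pd i Cf) (CkS Cg); have C2 := IH _ _ (CkS Cf) (Ck_pd i Cg).
apply: Ck_eq (Ck_add oU C1 C2) => // y Uy.
by rewrite pdM //; apply: Ck_derivable Uy; eassumption.
Qed.

Lemma Ck_inv m k (U : set 'rV[R]_m) f :
  open U -> Ck_on k U f -> (forall x, U x -> f x != 0) ->
  Ck_on k U (fun x => (f x)^-1).
Proof.
move=> oU + f0; elim: k => [|k IH] Cf; split => //;
  try by move=> x Ux; apply: (continuousV (f0 x Ux) (Ck_continuous Cf Ux)).
move=> i; split.
  by move=> x Ux; have := @derivableV _ _ f x _ (f0 x Ux) (Ck_derivable Cf Ux); exact.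
have C1 := Ck_mul oU (IH (CkS Cf)) (IH (CkS Cf)).
apply: Ck_eq (Ck_mul oU (Ck_cst k U (-1)) (Ck_mul oU C1 (Ck_pd i Cf))) => // y Uy.
rewrite /pd [RHS](deriveV (f0 y Uy) (Ck_derivable Cf Uy)) /GRing.scale /=.
by rewrite -exprVn expr2; ring.
Qed.

Lemma continuous_row (T : topologicalType) n (f : T -> 'rV[R]_n) (x : T) :
  (forall a, {for x, continuous (fun y => f y 0 a)}) -> {for x, continuous f}.
Proof.
move=> cf; apply/cvgrPdist_le => e e0; near=> y.
apply: norm_row_le => [|a]; first exact: ltW.
rewrite !mxE; move: a; near: y; apply: filter_forall => a.
by have /cvgrPdist_le/(_ _ e0) := cf a.
Unshelve. all: by end_near. Qed.

(** The hypothesis on [f] is componentwise, so that C^k arguments apply to the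
    sum of products on the right-hand side. *)
Lemma pd_comp m n (g : 'rV[R]_n -> R) (f : 'rV[R]_m -> 'rV[R]_n) (i : 'I_m)
    (V : set 'rV[R]_n) x :
  open V -> Ck_on 1 V g -> V (f x) ->
  (forall a, derivable (fun y => f y 0 a) x (delta_mx 0 i)) ->
  is_derive x (delta_mx 0 i) (fun y => g (f y))
     (\sum_b pd i (fun y => f y 0 b) x * pd b g (f x)).
Proof.
move=> oV Cg Vfx df.
have dg : differentiable g (f x).
  apply: C1_differentiable.
    by apply: filterS (near_open oV Vfx) => y Vy j; exact: Ck_derivable Cg Vy.
  by move=> j; exact: Ck_continuous (Ck_pd j Cg) Vfx.
have dfx : derivable f x (delta_mx 0 i).
  by apply: (iffRL (derivable_mxP _ _ _)) => a b; rewrite [a]ord1; exact: df.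
apply: is_derive_eq (derive_chain dg dfx) _.
by apply: eq_bigr => b _; rewrite (derive_mx dfx) mxE.
Qed.

(** Induction on [k]: the partial derivatives of [g o f] are sums of products of
    those of [f] with compositions of partial derivatives of [g] with [f]. *)
Lemma Ck_comp m n k (U : set 'rV[R]_m) (V : set 'rV[R]_n)
    (g : 'rV[R]_n -> R) (f : 'rV[R]_m -> 'rV[R]_n) :
  open U -> open V -> Ck_on k V g -> (forall a, Ck_on k U (fun x => f x 0 a)) ->
  (forall x, U x -> V (f x)) -> Ck_on k U (fun x => g (f x)).
Proof.
move=> oU oV; elim: k g => [|k IH] g Cg Cf UV; split => //.
- move=> x Ux; apply: continuous_comp; last exact: Ck_continuous Cg (UV x Ux).
  by apply: continuous_row => a; exact: Ck_continuous (Cf a) Ux.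
- move=> x Ux; apply: continuous_comp; last exact: Ck_continuous Cg (UV x Ux).
  by apply: continuous_row => a; exact: Ck_continuous (Cf a) Ux.
have Cg1 : Ck_on 1 V g by move: (Cg); clear; elim: k g => // k IH g /CkS/IH.
move=> i.
have D x (Ux : U x) : is_derive x (delta_mx 0 i) (fun y => g (f y))
     (\sum_b pd i (fun y => f y 0 b) x * pd b g (f x)).
  exact: pd_comp oV Cg1 (UV x Ux) (fun a => Ck_derivable (Cf a) Ux).
split; first by move=> x Ux; exact: (@ex_derive _ _ _ _ _ _ _ (D x Ux)).
have C := Ck_sum (index_enum 'I_n) oU (fun b (_ : predT b) =>
   Ck_mul oU (Ck_pd i (Cf b)) (IH _ (Ck_pd b Cg) (fun a => CkS (Cf a)) UV)).
by apply: Ck_eq C => // x Ux; rewrite /pd (@derive_val _ _ _ _ _ _ _ (D x Ux)).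
Qed.

End CkFunctions.

(** * Smooth matrix-valued functions *)

Section SmoothMatrices.
Context {R : realType}.
Implicit Types m n p q : nat.

Definition smooth m (U : set 'rV[R]_m) (f : 'rV[R]_m -> R) : Prop :=
  forall k, Ck_on k U f.

Definition smooth_mx m p q (U : set 'rV[R]_m) (A : 'rV[R]_m -> 'M[R]_(p, q)) :
    Prop :=
  forall a b, smooth U (fun x => A x a b).

Lemma smooth_onP m n (U : set 'rV[R]_m) (f : 'rV[R]_m -> 'rV[R]_n) :
  smooth_on U f <-> smooth_mx U f.
Proof. by split=> [sf i a k|sf a k]; [rewrite [i]ord1; exact: sf|exact: sf]. Qed.

Lemma smooth_derivable m (U : set 'rV[R]_m) f (i : 'I_m) x :
  smooth U f -> U x -> derivable f x (delta_mx 0 i).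
Proof. by move=> /(_ 1%N); exact: Ck_derivable. Qed.

Lemma smooth_pd m (U : set 'rV[R]_m) f (i : 'I_m) :
  smooth U f -> smooth U (pd i f).
Proof. by move=> sf k; exact: Ck_pd (sf k.+1). Qed.

Lemma smooth_eq m (U : set 'rV[R]_m) f g :
  open U -> (forall y, U y -> f y = g y) -> smooth U f -> smooth U g.
Proof. by move=> oU fg sf k; exact: Ck_eq (sf k). Qed.

Lemma smooth_cst m (U : set 'rV[R]_m) (a : R) : smooth U (fun=> a).
Proof. by move=> k; exact: Ck_cst. Qed.

Lemma smooth_add m (U : set 'rV[R]_m) f g :
  open U -> smooth U f -> smooth U g -> smooth U (fun x => f x + g x).
Proof. by move=> oU sf sg k; exact: Ck_add. Qed.

Lemma smooth_mul m (U : set 'rV[R]_m) f g :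
  open U -> smooth U f -> smooth U g -> smooth U (fun x => f x * g x).
Proof. by move=> oU sf sg k; exact: Ck_mul. Qed.

Lemma smooth_sum m (U : set 'rV[R]_m) (I : Type) (r : seq I) (P : pred I)
    (f : I -> 'rV[R]_m -> R) :
  open U -> (forall i, P i -> smooth U (f i)) ->
  smooth U (fun x => \sum_(i <- r | P i) f i x).
Proof. by move=> oU sf k; apply: Ck_sum => // i Pi; exact: sf. Qed.

Lemma smooth_prod m (U : set 'rV[R]_m) (I : Type) (r : seq I)
    (f : I -> 'rV[R]_m -> R) :
  open U -> (forall i, smooth U (f i)) ->
  smooth U (fun x => \prod_(i <- r) f i x).
Proof.
move=> oU sf; elim: r => [|i r IH].
  by apply: smooth_eq (smooth_cst U 1) => // x _; rewrite big_nil.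
by apply: smooth_eq (smooth_mul oU (sf i) IH) => // x _; rewrite big_cons.
Qed.

Lemma smooth_opp m (U : set 'rV[R]_m) f :
  open U -> smooth U f -> smooth U (fun x => - f x).
Proof.
move=> oU sf; apply: smooth_eq (smooth_mul oU (smooth_cst U (-1)) sf) => // x _.
by rewrite mulN1r.
Qed.

Lemma smooth_comp m n (U : set 'rV[R]_m) (V : set 'rV[R]_n)
    (g : 'rV[R]_n -> R) (f : 'rV[R]_m -> 'rV[R]_n) :
  open U -> open V -> smooth V g -> smooth_mx U f ->
  (forall x, U x -> V (f x)) -> smooth U (fun x => g (f x)).
Proof.
by move=> oU oV sg sf UV k; apply: Ck_comp (sg k) _ UV => // a; exact: sf.
Qed.

Lemma smooth_mx_comp m n p q (U : set 'rV[R]_m) (V : set 'rV[R]_n)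
    (A : 'rV[R]_n -> 'M[R]_(p, q)) (f : 'rV[R]_m -> 'rV[R]_n) :
  open U -> open V -> smooth_mx V A -> smooth_mx U f ->
  (forall x, U x -> V (f x)) -> smooth_mx U (fun x => A (f x)).
Proof.
by move=> oU oV sA sf UV a b; exact: smooth_comp oU oV (sA a b) sf UV.
Qed.

Lemma smooth_mx_eq m p q (U : set 'rV[R]_m) (A B : 'rV[R]_m -> 'M[R]_(p, q)) :
  open U -> (forall y, U y -> A y = B y) -> smooth_mx U A -> smooth_mx U B.
Proof.
by move=> oU AB sA a b; apply: smooth_eq (sA a b) => // y Uy; rewrite AB.
Qed.

Lemma smooth_mx_sub m p q (U V : set 'rV[R]_m) (A : 'rV[R]_m -> 'M[R]_(p, q)) :
  V `<=` U -> smooth_mx U A -> smooth_mx V A.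
Proof. by move=> VU sA a b k; exact: Ck_sub VU (sA a b k). Qed.

Lemma smooth_mxD m p q (U : set 'rV[R]_m) (A B : 'rV[R]_m -> 'M[R]_(p, q)) :
  open U -> smooth_mx U A -> smooth_mx U B -> smooth_mx U (fun x => A x + B x).
Proof.
move=> oU sA sB a b; apply: smooth_eq (smooth_add oU (sA a b) (sB a b)) => // x _.
by rewrite mxE.
Qed.

Lemma smooth_mxN m p q (U : set 'rV[R]_m) (A : 'rV[R]_m -> 'M[R]_(p, q)) :
  open U -> smooth_mx U A -> smooth_mx U (fun x => - A x).
Proof.
by move=> oU sA a b; apply: smooth_eq (smooth_opp oU (sA a b)) => // x _; rewrite mxE.
Qed.

Lemma smooth_mxZ m p q (U : set 'rV[R]_m) g (A : 'rV[R]_m -> 'M[R]_(p, q)) :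
  open U -> smooth U g -> smooth_mx U A -> smooth_mx U (fun x => g x *: A x).
Proof.
by move=> oU sg sA a b; apply: smooth_eq (smooth_mul oU sg (sA a b)) => // x _; rewrite mxE.
Qed.

Lemma smooth_mx_sum m p q (U : set 'rV[R]_m) (I : Type) (r : seq I)
    (A : I -> 'rV[R]_m -> 'M[R]_(p, q)) :
  open U -> (forall i, smooth_mx U (A i)) ->
  smooth_mx U (fun x => \sum_(i <- r) A i x).
Proof.
move=> oU sA a b.
apply: smooth_eq (@smooth_sum _ U I r predT _ oU (fun i _ => sA i a b)) => // x _.
by rewrite summxE.
Qed.

Lemma smooth_mxM m p q s (U : set 'rV[R]_m) (A : 'rV[R]_m -> 'M[R]_(p, q))
    (B : 'rV[R]_m -> 'M[R]_(q, s)) :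
  open U -> smooth_mx U A -> smooth_mx U B -> smooth_mx U (fun x => A x *m B x).
Proof.
move=> oU sA sB a b.
apply: smooth_eq (@smooth_sum _ U _ (index_enum 'I_q) predT _ oU
  (fun i _ => smooth_mul oU (sA a i) (sB i b))) => // x _.
by rewrite mxE.
Qed.

Lemma smooth_mx_tr m p q (U : set 'rV[R]_m) (A : 'rV[R]_m -> 'M[R]_(p, q)) :
  open U -> smooth_mx U A -> smooth_mx U (fun x => (A x)^T).
Proof. by move=> oU sA a b; apply: smooth_eq (sA b a) => // x _; rewrite mxE. Qed.

Lemma smooth_det m p (U : set 'rV[R]_m) (A : 'rV[R]_m -> 'M[R]_p) :
  open U -> smooth_mx U A -> smooth U (fun x => \det (A x)).
Proof.
move=> oU sA; rewrite /determinant; apply: smooth_sum => // s _.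
by apply: smooth_mul => //; [exact: smooth_cst|apply: smooth_prod].
Qed.

(** Cramer's formula. *)
Lemma smooth_invmx m p (U : set 'rV[R]_m) (A : 'rV[R]_m -> 'M[R]_p) :
  open U -> smooth_mx U A -> (forall x, U x -> A x \in unitmx) ->
  smooth_mx U (fun x => invmx (A x)).
Proof.
move=> oU sA uA; pose B x := (\det (A x))^-1 *: \adj (A x).
have detA x : U x -> \det (A x) != 0.
  by move=> /uA; rewrite unitmxE unitfE.
have sB : smooth_mx U B.
  apply: smooth_mxZ => //; first by move=> k; apply: Ck_inv => //; exact: smooth_det.
  move=> a b; rewrite /adjugate /cofactor.
  have sm : smooth U (fun x => (-1) ^+ (b + a) * \det (row' b (col' a (A x)))).
    apply: smooth_mul => //; first exact: smooth_cst.
    by apply: smooth_det => // c d; apply: smooth_eq (sA _ _) => // x _; rewrite !mxE.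
  by apply: smooth_eq sm => // x _; rewrite mxE.
by apply: smooth_mx_eq sB => // x Ux; rewrite /invmx uA.
Qed.

(** Differentiating matrices entrywise makes the product and chain rules matrix
    identities; for row vectors it is [dcoord] ([dcoordE]). *)
Definition dmx m p q (i : 'I_m) (A : 'rV[R]_m -> 'M[R]_(p, q)) (x : 'rV[R]_m) :
    'M[R]_(p, q) :=
  \matrix_(a, b) pd i (fun y => A y a b) x.

Lemma dcoordE m n (f : 'rV[R]_m -> 'rV[R]_n) i : dcoord f i = dmx i f.
Proof. by apply/funext => x; apply/matrixP => a b; rewrite !mxE [a]ord1. Qed.

Lemma jac_row m n (f : 'rV[R]_m -> 'rV[R]_n) i x : row i (jac f x) = dmx i f x.
Proof. by rewrite -dcoordE. Qed.

Lemma jacE m n (f : 'rV[R]_m -> 'rV[R]_n) x i a : jac f x i a = dmx i f x 0 a.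
Proof. by rewrite !mxE. Qed.

Lemma smooth_dmx m p q (U : set 'rV[R]_m) (A : 'rV[R]_m -> 'M[R]_(p, q)) i :
  open U -> smooth_mx U A -> smooth_mx U (dmx i A).
Proof.
move=> oU sA a b; apply: smooth_eq (smooth_pd i (sA a b)) => // x _.
by rewrite mxE.
Qed.

Lemma smooth_jac m n (U : set 'rV[R]_m) (f : 'rV[R]_m -> 'rV[R]_n) :
  open U -> smooth_mx U f -> smooth_mx U (jac f).
Proof.
move=> oU sf i a; apply: smooth_eq (smooth_dmx i oU sf 0 a) => // x _.
by rewrite jacE.
Qed.

Lemma dmx_eq m p q (U : set 'rV[R]_m) (A B : 'rV[R]_m -> 'M[R]_(p, q)) i x :
  open U -> (forall y, U y -> A y = B y) -> U x -> dmx i A x = dmx i B x.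
Proof.
move=> oU AB Ux; apply/matrixP => a b; rewrite !mxE.
by apply: (pd_eq i oU) => // y Uy; rewrite AB.
Qed.

Lemma pd_cst m (i : 'I_m) (a : R) (x : 'rV[R]_m) : pd i (fun=> a) x = 0.
Proof. exact: derive_cst. Qed.

Lemma dmx_cst m p q (i : 'I_m) (A : 'M[R]_(p, q)) x : dmx i (fun=> A) x = 0.
Proof. by apply/matrixP => a b; rewrite !mxE pd_cst. Qed.

Lemma pdD m (U : set 'rV[R]_m) (f g : 'rV[R]_m -> R) (i : 'I_m) x :
  smooth U f -> smooth U g -> U x ->
  pd i (fun y => f y + g y) x = pd i f x + pd i g x.
Proof.
move=> sf sg Ux.
by rewrite /pd [LHS](deriveD (smooth_derivable sf Ux) (smooth_derivable sg Ux)).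
Qed.

Lemma pd_sum m (U : set 'rV[R]_m) (I : Type) (r : seq I)
    (f : I -> 'rV[R]_m -> R) (i : 'I_m) x :
  open U -> (forall k, smooth U (f k)) -> U x ->
  pd i (fun y => \sum_(k <- r) f k y) x = \sum_(k <- r) pd i (f k) x.
Proof.
move=> oU sf Ux; elim: r => [|k r IH].
  rewrite big_nil -[RHS](pd_cst i 0 x); congr (pd i _ x); apply/funext => y.
  by rewrite big_nil.
rewrite big_cons -IH -(@pdD _ U) //; last by apply: smooth_sum.
by congr (pd i _ x); apply/funext => y; rewrite big_cons.
Qed.

Lemma pd_mul m (U : set 'rV[R]_m) (f g : 'rV[R]_m -> R) (i : 'I_m) x :
  smooth U f -> smooth U g -> U x ->
  pd i (fun y => f y * g y) x = pd i f x * g x + f x * pd i g x.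
Proof.
move=> sf sg Ux.
exact: (pdM (smooth_derivable sf Ux) (smooth_derivable sg Ux)).
Qed.

Lemma dmxD m p q (U : set 'rV[R]_m) (A B : 'rV[R]_m -> 'M[R]_(p, q)) i x :
  smooth_mx U A -> smooth_mx U B -> U x ->
  dmx i (fun y => A y + B y) x = dmx i A x + dmx i B x.
Proof.
move=> sA sB Ux; apply/matrixP => a b; rewrite !mxE -(pdD i (sA a b) (sB a b) Ux).
by congr (pd i _ x); apply/funext => y; rewrite mxE.
Qed.

Lemma dmxM m p q s (U : set 'rV[R]_m) (A : 'rV[R]_m -> 'M[R]_(p, q))
    (B : 'rV[R]_m -> 'M[R]_(q, s)) i x :
  open U -> smooth_mx U A -> smooth_mx U B -> U x ->
  dmx i (fun y => A y *m B y) x = dmx i A x *m B x + A x *m dmx i B x.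
Proof.
move=> oU sA sB Ux; apply/matrixP => a b; rewrite !mxE -big_split /=.
have -> : (fun y => (A y *m B y) a b) = (fun y => \sum_j A y a j * B y j b).
  by apply/funext => y; rewrite mxE.
rewrite (@pd_sum _ U) //; last by move=> k; apply: smooth_mul.
by apply: eq_bigr => j _; rewrite !mxE (@pd_mul _ U).
Qed.

Lemma dmxZ m p q (U : set 'rV[R]_m) g (A : 'rV[R]_m -> 'M[R]_(p, q)) i x :
  smooth U g -> smooth_mx U A -> U x ->
  dmx i (fun y => g y *: A y) x = pd i g x *: A x + g x *: dmx i A x.
Proof.
move=> sg sA Ux; apply/matrixP => a b; rewrite !mxE -(pd_mul i sg (sA a b) Ux).
by congr (pd i _ x); apply/funext => y; rewrite mxE.
Qed.

Lemma dmx_sum m p q (U : set 'rV[R]_m) (I : Type) (r : seq I)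
    (A : I -> 'rV[R]_m -> 'M[R]_(p, q)) i x :
  open U -> (forall k, smooth_mx U (A k)) -> U x ->
  dmx i (fun y => \sum_(k <- r) A k y) x = \sum_(k <- r) dmx i (A k) x.
Proof.
move=> oU sA Ux; apply/matrixP => a b; rewrite summxE mxE.
under [RHS]eq_bigr do rewrite mxE.
rewrite -(@pd_sum _ U _ r (fun k y => A k y a b)) //; last by move=> k; exact: sA.
by congr (pd i _ x); apply/funext => y; rewrite summxE.
Qed.

Lemma dmx_tr m p q (A : 'rV[R]_m -> 'M[R]_(p, q)) i x :
  dmx i (fun y => (A y)^T) x = (dmx i A x)^T.
Proof.
apply/matrixP => a b; rewrite !mxE; congr (pd i _ x); apply/funext => y.
by rewrite mxE.
Qed.

Lemma dmx_comp m n p q (U : set 'rV[R]_m) (V : set 'rV[R]_n)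
    (A : 'rV[R]_n -> 'M[R]_(p, q)) (f : 'rV[R]_m -> 'rV[R]_n) i x :
  open V -> smooth_mx V A -> smooth_mx U f -> U x -> V (f x) ->
  dmx i (fun y => A (f y)) x = \sum_b dmx i f x 0 b *: dmx b A (f x).
Proof.
move=> oV sA sf Ux Vfx; apply/matrixP => a b; rewrite summxE !mxE.
have df c : derivable (fun y => f y 0 c) x (delta_mx 0 i).
  exact: smooth_derivable (sf 0 c) Ux.
rewrite /pd (@derive_val _ _ _ _ _ _ _ (pd_comp oV (sA a b 1%N) Vfx df)).
by apply: eq_bigr => c _; rewrite !mxE.
Qed.

Lemma dmx_comp_jac m n p (U : set 'rV[R]_m) (V : set 'rV[R]_n)
    (g : 'rV[R]_n -> 'rV[R]_p) (f : 'rV[R]_m -> 'rV[R]_n) i x :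
  open V -> smooth_mx V g -> smooth_mx U f -> U x -> V (f x) ->
  dmx i (fun y => g (f y)) x = dmx i f x *m jac g (f x).
Proof.
move=> oV sg sf Ux Vfx; rewrite (dmx_comp i oV sg sf Ux Vfx).
rewrite mulmx_sum_row; apply: eq_bigr => b _; by rewrite jac_row.
Qed.

Lemma dmxC m p q (U : set 'rV[R]_m) (A : 'rV[R]_m -> 'M[R]_(p, q)) i j x :
  open U -> smooth_mx U A -> U x -> dmx i (dmx j A) x = dmx j (dmx i A) x.
Proof.
move=> oU sA Ux; apply/matrixP => a b; rewrite [LHS]mxE [RHS]mxE.
have E k : (fun y => dmx k A y a b) = pd k (fun y => A y a b).
  by apply/funext => y; rewrite mxE.
rewrite (E i) (E j); exact: (@schwarz R m U (fun y => A y a b) x j i oU (sA a b 2%N) Ux).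
Qed.

End SmoothMatrices.

(** * Christoffel symbols and the pullback connection *)

Section Connection.
Context {R : realType}.
Implicit Types m n p q : nat.

Definition metric_on m (U : set 'rV[R]_m) (G : 'rV[R]_m -> 'M[R]_m) : Prop :=
  [/\ smooth_mx U G, forall x, U x -> (G x)^T = G x &
      forall x, U x -> forall v : 'rV[R]_m, v != 0 -> 0 < inner (G x) v v].

Lemma metric_on_sub m (U V : set 'rV[R]_m) G :
  V `<=` U -> metric_on U G -> metric_on V G.
Proof.
move=> VU [sG tG pG]; split.
- exact: smooth_mx_sub VU sG.
- by move=> x /VU; exact: tG.
- by move=> x /VU; exact: pG.
Qed.

Lemma posdef_unit m (A : 'M[R]_m) :
  (forall v : 'rV[R]_m, v != 0 -> 0 < inner A v v) -> A \in unitmx.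
Proof.
move=> pA; rewrite -row_free_unit -kermx_eq0; apply/rowV0P => v /sub_kermxP vA.
apply/eqP; apply: contraT => /pA; by rewrite /inner vA mul0mx mxE ltxx.
Qed.

Lemma metric_unit m (U : set 'rV[R]_m) G x :
  metric_on U G -> U x -> G x \in unitmx.
Proof. by move=> [_ _ pG] Ux; exact: posdef_unit (pG x Ux). Qed.

Lemma trmx_invmx m (A : 'M[R]_m) : A^T = A -> (invmx A)^T = invmx A.
Proof. by move=> tA; rewrite trmx_inv tA. Qed.

(** Used for contractions of Christoffel symbols with two vectors, and for second
    derivatives. *)
Definition bil n p (B : 'I_n -> 'I_n -> 'rV[R]_p) (u v : 'rV[R]_n) : 'rV[R]_p :=
  \sum_b \sum_c (u 0 b * v 0 c) *: B b c.

Lemma eq_bil n p (B B' : 'I_n -> 'I_n -> 'rV[R]_p) u v :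
  (forall b c, B b c = B' b c) -> bil B u v = bil B' u v.
Proof. by move=> BB; apply: eq_bigr => b _; apply: eq_bigr => c _; rewrite BB. Qed.

Lemma bil_linearl n p (B : 'I_n -> 'I_n -> 'rV[R]_p) v : linear (bil B ^~ v).
Proof.
move=> a u w; rewrite /bil scaler_sumr -big_split; apply: eq_bigr => b _ /=.
rewrite scaler_sumr -big_split; apply: eq_bigr => c _ /=.
by rewrite !mxE scalerA mulrA -scalerDl -mulrDl.
Qed.

Lemma bil_linearr n p (B : 'I_n -> 'I_n -> 'rV[R]_p) u : linear (bil B u).
Proof.
move=> a v w; rewrite /bil scaler_sumr -big_split; apply: eq_bigr => b _ /=.
rewrite scaler_sumr -big_split; apply: eq_bigr => c _ /=.
rewrite !mxE scalerA -scalerDl; congr (_ *: _); ring.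
Qed.

HB.instance Definition _ n p (B : 'I_n -> 'I_n -> 'rV[R]_p) u :=
  GRing.isLinear.Build R 'rV[R]_n 'rV[R]_p _ (bil B u) (bil_linearr B u).

Definition bilr n p (B : 'I_n -> 'I_n -> 'rV[R]_p) v u := bil B u v.
HB.instance Definition _ n p (B : 'I_n -> 'I_n -> 'rV[R]_p) v :=
  GRing.isLinear.Build R 'rV[R]_n 'rV[R]_p _ (bilr B v) (bil_linearl B v).

Lemma bilDr n p (B : 'I_n -> 'I_n -> 'rV[R]_p) u v w :
  bil B u (v + w) = bil B u v + bil B u w.
Proof. exact: linearD. Qed.

Lemma bil0l n p (B : 'I_n -> 'I_n -> 'rV[R]_p) v : bil B 0 v = 0.
Proof. exact: (linear0 (bilr B v)). Qed.

Lemma bil_suml n p (B : 'I_n -> 'I_n -> 'rV[R]_p) v (I : finType)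
    (a : I -> R) (u : I -> 'rV[R]_n) :
  bil B (\sum_i a i *: u i) v = \sum_i a i *: bil B (u i) v.
Proof.
rewrite -[LHS]/(bilr B v (\sum_i a i *: u i)) linear_sum.
by apply: eq_bigr => i _; rewrite linearZ.
Qed.

Lemma bil_sumr n p (B : 'I_n -> 'I_n -> 'rV[R]_p) u (I : finType)
    (a : I -> R) (v : I -> 'rV[R]_n) :
  bil B u (\sum_i a i *: v i) = \sum_i a i *: bil B u (v i).
Proof. by rewrite linear_sum; apply: eq_bigr => i _; rewrite linearZ. Qed.

Lemma bil_mulmx n p q (B : 'I_n -> 'I_n -> 'rV[R]_p) (A : 'M[R]_(p, q)) u v :
  bil B u v *m A = bil (fun b c => B b c *m A) u v.
Proof.
rewrite /bil mulmx_suml; apply: eq_bigr => b _.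
by rewrite mulmx_suml; apply: eq_bigr => c _; rewrite -scalemxAl.
Qed.

Lemma bil_add n p (B B' : 'I_n -> 'I_n -> 'rV[R]_p) u v :
  bil (fun b c => B b c + B' b c) u v = bil B u v + bil B' u v.
Proof.
rewrite /bil -big_split; apply: eq_bigr => b _ /=; rewrite -big_split.
by apply: eq_bigr => c _ /=; rewrite scalerDr.
Qed.

Lemma bil_comp n q p (B : 'I_q -> 'I_q -> 'rV[R]_p) (A : 'M[R]_(n, q)) u v :
  bil B (u *m A) (v *m A) = bil (fun b c => bil B (row b A) (row c A)) u v.
Proof.
rewrite [u *m A]mulmx_sum_row bil_suml [RHS]/bil; apply: eq_bigr => b _.
rewrite [v *m A]mulmx_sum_row bil_sumr.
by rewrite scaler_sumr; apply: eq_bigr => c _; rewrite scalerA.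
Qed.

(** The Christoffel symbols Gamma^k_ij as a row vector in [k]: this is the
    covariant derivative of the j-th coordinate field in the i-th direction. *)
Definition gamma m (G : 'rV[R]_m -> 'M[R]_m) (x : 'rV[R]_m) (i j : 'I_m) :
    'rV[R]_m :=
  \row_k christoffel G x k i j.

(** Christoffel symbols of the first kind, with the upper index lowered. *)
Definition gamma_low m (G : 'rV[R]_m -> 'M[R]_m) (x : 'rV[R]_m) (i j : 'I_m) :
    'rV[R]_m :=
  \row_l (2^-1 * (dmx i G x j l + dmx j G x i l - dmx l G x i j)).

Lemma gammaE m (G : 'rV[R]_m -> 'M[R]_m) x i j :
  gamma G x i j = gamma_low G x i j *m (invmx (G x))^T.
Proof.
apply/rowP => k; rewrite !mxE /christoffel mulr_sumr; apply: eq_bigr => l _.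
by rewrite !mxE [RHS]mulrC mulrCA.
Qed.

Lemma nablaE m n (H : 'rV[R]_n -> 'M[R]_n) (f W : 'rV[R]_m -> 'rV[R]_n) i x :
  nabla H f i W x = dmx i W x + bil (gamma H (f x)) (dmx i f x) (W x).
Proof.
apply/rowP => a; rewrite !mxE; congr (_ + _); rewrite summxE.
apply: eq_bigr => b _; rewrite summxE; apply: eq_bigr => c _.
by rewrite dcoordE [RHS]mxE [gamma _ _ _ _ _ _]mxE -mulrA mulrC.
Qed.

Lemma smooth_gamma m (U : set 'rV[R]_m) G i j :
  open U -> metric_on U G -> smooth_mx U (fun x => gamma G x i j).
Proof.
move=> oU mG; have [sG _ _] := mG.
have sI : smooth_mx U (fun x => (invmx (G x))^T).
  apply: smooth_mx_tr => //; apply: smooth_invmx => // x; exact: metric_unit.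
suff sL : smooth_mx U (fun x => gamma_low G x i j).
  by apply: smooth_mx_eq (smooth_mxM oU sL sI) => // x _; rewrite gammaE.
move=> a l.
have sd b c d : smooth U (fun x => dmx b G x c d) by exact: smooth_dmx.
have := smooth_mul oU (smooth_cst U 2^-1) (smooth_add oU (smooth_add oU (sd i j l) (sd j i l))
  (smooth_opp oU (sd l i j))).
apply: smooth_eq => // x _.
by rewrite [RHS]mxE.
Qed.

Lemma smooth_bil m n p (U : set 'rV[R]_m) (B : 'rV[R]_m -> 'I_n -> 'I_n -> 'rV[R]_p)
    (u v : 'rV[R]_m -> 'rV[R]_n) :
  open U -> (forall b c, smooth_mx U (fun x => B x b c)) ->
  smooth_mx U u -> smooth_mx U v -> smooth_mx U (fun x => bil (B x) (u x) (v x)).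
Proof.
move=> oU sB su sv; apply: smooth_mx_sum => // b; apply: smooth_mx_sum => // c.
by apply: smooth_mxZ => //; apply: smooth_mul.
Qed.

Lemma smooth_nabla m n (U : set 'rV[R]_m) (V : set 'rV[R]_n) H
    (f W : 'rV[R]_m -> 'rV[R]_n) i :
  open U -> open V -> metric_on V H -> smooth_mx U f ->
  (forall x, U x -> V (f x)) -> smooth_mx U W -> smooth_mx U (nabla H f i W).
Proof.
move=> oU oV mH sf UV sW.
have sG b c : smooth_mx U (fun x => gamma H (f x) b c).
  exact: (smooth_mx_comp (A := fun y => gamma H y b c) oU oV (smooth_gamma b c oV mH) sf UV).
apply: smooth_mx_eq (smooth_mxD oU (smooth_dmx i oU sW)
  (smooth_bil oU sG (smooth_dmx i oU sf) sW)) => // x _.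
by rewrite nablaE.
Qed.

Lemma bformE n (A : 'M[R]_n) (u v : 'rV[R]_n) :
  inner A u v = \sum_b \sum_c u 0 b * v 0 c * A b c.
Proof.
rewrite /inner mxE exchange_big /=; apply: eq_bigr => c _.
by rewrite !mxE mulr_suml; apply: eq_bigr => b _; ring.
Qed.

Lemma innerC n (A : 'M[R]_n) (u v : 'rV[R]_n) : A^T = A -> inner A u v = inner A v u.
Proof.
move=> tA; rewrite /inner.
have -> : v *m A *m u^T = (u *m A *m v^T)^T by rewrite !trmx_mul trmxK tA mulmxA.
by rewrite [RHS]mxE.
Qed.

End Connection.

(** * Local isometries *)

Section LocalIsometry.
Context {R : realType}.
Implicit Types m n p q : nat.

(** [G] is the pullback of [G'] by [th]; when [G] is nondegenerate, the
    differential of [th] is therefore invertible. *)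
Definition isometry_on m (U U' : set 'rV[R]_m) (G G' : 'rV[R]_m -> 'M[R]_m)
    (th : 'rV[R]_m -> 'rV[R]_m) : Prop :=
  [/\ smooth_mx U th, forall x, U x -> U' (th x) &
      forall x, U x -> G x = jac th x *m G' (th x) *m (jac th x)^T].

(** The inverse metrics are related by the transpose of the congruence that
    relates the metrics. *)
Lemma invmx_congr m (G G' J : 'M[R]_m) :
  G \in unitmx -> G = J *m G' *m J^T -> J^T *m invmx G *m J = invmx G'.
Proof.
move=> uG GE.
have E : (J^T *m invmx G *m J) *m G' = 1%:M.
  have := mulVmx uG; rewrite {2}GE !mulmxA => /mulmx1C.
  by rewrite !mulmxA.
have [_ uG'] := mulmx1_unit E.
by rewrite -[LHS](mulmxK uG') E mul1mx.
Qed.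

(** Christoffel symbols of the first kind contracted with three vectors: the three
    terms differ in the vector which is the direction of differentiation. *)
Lemma trilinear_reindex m (u v w : 'rV[R]_m) (F : 'I_m -> 'M[R]_m) :
  2^-1 * (\sum_a u 0 a * inner (F a) v w + \sum_a v 0 a * inner (F a) u w
          - \sum_a w 0 a * inner (F a) u v) =
  (bil (fun b c => \row_l (2^-1 * (F b c l + F c b l - F l b c))) u v *m w^T) 0 0.
Proof.
rewrite mxE.
have E1 : \sum_a u 0 a * inner (F a) v w =
    \sum_l \sum_b \sum_c u 0 b * v 0 c * w 0 l * F b c l.
  rewrite exchange_big /=; apply: eq_bigr => b _.
  rewrite bformE mulr_sumr exchange_big /=; apply: eq_bigr => c _.
  by rewrite mulr_sumr; apply: eq_bigr => l _; ring.
have E2 : \sum_a v 0 a * inner (F a) u w =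
    \sum_l \sum_b \sum_c u 0 b * v 0 c * w 0 l * F c b l.
  under [RHS]eq_bigr do rewrite exchange_big /=.
  rewrite exchange_big /=; apply: eq_bigr => c _.
  rewrite bformE mulr_sumr exchange_big /=; apply: eq_bigr => b _.
  by rewrite mulr_sumr; apply: eq_bigr => l _; ring.
have E3 : \sum_a w 0 a * inner (F a) u v =
    \sum_l \sum_b \sum_c u 0 b * v 0 c * w 0 l * F l b c.
  apply: eq_bigr => l _.
  rewrite bformE mulr_sumr; apply: eq_bigr => b _.
  by rewrite mulr_sumr; apply: eq_bigr => c _; ring.
rewrite E1 E2 E3 -big_split -sumrB /= mulr_sumr; apply: eq_bigr => l _.
rewrite -big_split -sumrB /= mulr_sumr mxE summxE mulr_suml.
apply: eq_bigr => b _.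
rewrite -big_split -sumrB /= mulr_sumr summxE mulr_suml.
by apply: eq_bigr => c _; rewrite !mxE; ring.
Qed.

Section Christoffel.
Context m (U U' : set 'rV[R]_m) (G G' : 'rV[R]_m -> 'M[R]_m)
  (th : 'rV[R]_m -> 'rV[R]_m).
Hypotheses (oU : open U) (oU' : open U') (mG : metric_on U G)
  (mG' : metric_on U' G') (iso : isometry_on U U' G G' th).

(** Leibniz rule for g_jl = <d_j th, d_l th>. *)
Lemma dmx_metric_isometry x i j l : U x ->
  dmx i G x j l =
    inner (G' (th x)) (dmx i (dmx j th) x) (dmx l th x) +
    inner (G' (th x)) (dmx i (dmx l th) x) (dmx j th x) +
    \sum_a dmx i th x 0 a * inner (dmx a G' (th x)) (dmx j th x) (dmx l th x).
Proof.
move=> Ux; have [sth thU GE] := iso; have [sG' tG' _] := mG'.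
have sd k : smooth_mx U (dmx k th) by exact: smooth_dmx.
have sG'th : smooth_mx U (fun y => G' (th y)).
  exact: smooth_mx_comp oU oU' sG' sth thU.
have GjlE y : U y -> G y j l = (dmx j th y *m G' (th y) *m (dmx l th y)^T) 0 0.
  move=> Uy; rewrite GE // -!jac_row -row_mul.
  by rewrite [LHS]mxE [RHS]mxE; apply: eq_bigr => c _; rewrite !mxE.
rewrite mxE (pd_eq i oU GjlE Ux).
have -> (A : 'rV[R]_m -> 'M[R]_1) : pd i (fun y => A y 0 0) x = dmx i A x 0 0.
  by rewrite mxE.
have sdG : smooth_mx U (fun y => dmx j th y *m G' (th y)) by exact: smooth_mxM.
rewrite (dmxM i oU sdG (smooth_mx_tr oU (sd l)) Ux) (dmxM i oU (sd j) sG'th Ux).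
rewrite dmx_tr (dmx_comp i oU' sG' sth Ux (thU x Ux)).
rewrite mulmxDl addrAC mxE [X in X + _]mxE -/(inner _ _ _) -/(inner _ _ _).
congr (_ + _ + _); first by rewrite innerC // tG' //; exact: thU.
rewrite mulmx_sumr mulmx_suml summxE; apply: eq_bigr => a _.
by rewrite -scalemxAr -scalemxAl mxE.
Qed.

(** In the alternating sum of the three derivatives of the metric, symmetry of
    second derivatives makes all terms in the second derivatives of [th] cancel
    except twice <d_i d_j th, d_l th>. *)
Lemma gamma_low_isometry x i j : U x ->
  gamma_low G x i j =
    (dmx i (dmx j th) x *m G' (th x) +
     bil (gamma_low G' (th x)) (dmx i th x) (dmx j th x)) *m (jac th x)^T.
Proof.
move=> Ux; have [sth _ _] := iso.
apply/rowP => l; rewrite mxE !(dmx_metric_isometry _ _ _ Ux).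
have C a b : dmx a (dmx b th) x = dmx b (dmx a th) x by exact: dmxC oU sth Ux.
rewrite (C j i) (C l i) (C l j).
have -> (v : 'rV[R]_m) : (v *m (jac th x)^T) 0 l = (v *m (dmx l th x)^T) 0 0.
  by rewrite -jac_row [LHS]mxE [RHS]mxE; apply: eq_bigr => c _; rewrite !mxE.
rewrite mulmxDl mxE -/(inner _ _ _).
rewrite -(trilinear_reindex _ _ _ (fun a => dmx a G' (th x))).
have arith (p1 p2 p3 s1 s2 s3 : R) :
    2^-1 * (p1 + p2 + s1 + (p1 + p3 + s2) - (p2 + p3 + s3)) =
    p1 + 2^-1 * (s1 + s2 - s3) by field.
exact: arith.
Qed.

(** Local isometries are affine: their second fundamental form vanishes. For
    changes of charts this is the transformation law of Christoffel symbols. *)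
Lemma gamma_isometry x i j : U x ->
  gamma G x i j *m jac th x = nabla G' th i (dmx j th) x.
Proof.
move=> Ux; have [sth thU GE] := iso; have [_ tG _] := mG; have [_ tG' _] := mG'.
have uG := metric_unit mG Ux; have uG' := metric_unit mG' (thU x Ux).
rewrite gammaE gamma_low_isometry // trmx_invmx ?tG // -!mulmxA.
rewrite (mulmxA (jac th x)^T) (invmx_congr uG (GE x Ux)).
rewrite mulmxDl mulmxK // nablaE; congr (_ + _).
rewrite bil_mulmx; apply: eq_bil => b c.
by rewrite gammaE trmx_invmx // tG' //; exact: thU.
Qed.

End Christoffel.
End LocalIsometry.

(** * Covariant derivatives under changes of coordinates *)

Section ChangeOfCoordinates.
Context {R : realType}.
Implicit Types m n p q : nat.

(** The trace over M of the covariant derivative of a 1-form [al] with values in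
    the pullback of TN. The tension field is the case [al] = df and the rough
    Laplacian of W is minus the case [al] = nabla W, so both are handled at once.
    The domain of [f] is allowed to be a space of parameters over M, with
    projection [pi] to M, in which [r] selects the directions of M: space-time is
    used to differentiate in time, and [r], [pi] are identities for a single
    map. *)
Definition covdiv q m n (r : 'I_m -> 'I_q) (pi : 'rV[R]_q -> 'rV[R]_m)
    (G : 'rV[R]_m -> 'M[R]_m) (H : 'rV[R]_n -> 'M[R]_n)
    (f : 'rV[R]_q -> 'rV[R]_n) (al : 'I_m -> 'rV[R]_q -> 'rV[R]_n)
    (z : 'rV[R]_q) : 'rV[R]_n :=
  trg (G (pi z)) (fun i j => nabla H f (r i) (al j) z
    - \sum_k christoffel G (pi z) k i j *: al k z).

Lemma nabla_eq m n (U : set 'rV[R]_m) (H : 'rV[R]_n -> 'M[R]_n) f f' W W' i x :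
  open U -> (forall y, U y -> f y = f' y) -> (forall y, U y -> W y = W' y) ->
  U x -> nabla H f i W x = nabla H f' i W' x.
Proof.
move=> oU ff WW Ux; rewrite !nablaE (dmx_eq i oU WW Ux) (dmx_eq i oU ff Ux).
by rewrite ff // WW.
Qed.

Lemma nabla_leibniz m n (U : set 'rV[R]_m) (H : 'rV[R]_n -> 'M[R]_n) f i
    (I : finType) (g : I -> 'rV[R]_m -> R) (W : I -> 'rV[R]_m -> 'rV[R]_n) x :
  open U -> (forall b, smooth U (g b)) -> (forall b, smooth_mx U (W b)) -> U x ->
  nabla H f i (fun y => \sum_b g b y *: W b y) x =
  \sum_b pd i (g b) x *: W b x + \sum_b g b x *: nabla H f i (W b) x.
Proof.
move=> oU sg sW Ux; rewrite nablaE bil_sumr (@dmx_sum _ _ _ _ U) //; last first.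
  by move=> b; apply: smooth_mxZ.
under eq_bigr => b _ do rewrite (dmxZ i (sg b) (sW b) Ux).
rewrite big_split -addrA -big_split /=; congr (_ + _).
by apply: eq_bigr => b _; rewrite nablaE scalerDr.
Qed.

(** A trace does not depend on the basis. *)
Lemma trg_congr m (V : lmodType R) (G G' J : 'M[R]_m) (B B' : 'I_m -> 'I_m -> V) :
  G \in unitmx -> G = J *m G' *m J^T ->
  (forall i j, B i j = \sum_a \sum_b (J i a * J j b) *: B' a b) ->
  trg G B = trg G' B'.
Proof.
move=> uG GE BE; rewrite /trg -(invmx_congr uG GE).
have -> : \sum_i \sum_j invmx G i j *: B i j =
   \sum_i \sum_j \sum_a \sum_b (J i a * invmx G i j * J j b) *: B' a b.
  apply: eq_bigr => i _; apply: eq_bigr => j _; rewrite BE scaler_sumr.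
  apply: eq_bigr => a _; rewrite scaler_sumr; apply: eq_bigr => b _.
  by rewrite scalerA; congr (_ *: _); ring.
under eq_bigr do rewrite exchange_big /=.
rewrite exchange_big /=; apply: eq_bigr => a _.
under eq_bigr do rewrite exchange_big /=.
rewrite exchange_big /=; apply: eq_bigr => b _.
rewrite exchange_big mxE scaler_suml; apply: eq_bigr => j _ /=.
rewrite mxE mulr_suml scaler_suml; apply: eq_bigr => i _.
by rewrite mxE.
Qed.

Section Target.
Context m n (U : set 'rV[R]_m) (V V' : set 'rV[R]_n)
  (H H' : 'rV[R]_n -> 'M[R]_n) (ps : 'rV[R]_n -> 'rV[R]_n)
  (f f' : 'rV[R]_m -> 'rV[R]_n).
Hypotheses (oU : open U) (oV : open V) (oV' : open V') (mH : metric_on V H)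
  (mH' : metric_on V' H') (iso : isometry_on V V' H H' ps)
  (sf : smooth_mx U f) (UV : forall x, U x -> V (f x))
  (f'E : forall x, U x -> f' x = ps (f x)).

Lemma dmx_target i x : U x -> dmx i f' x = dmx i f x *m jac ps (f x).
Proof.
move=> Ux; have [sps _ _] := iso.
by rewrite (dmx_eq i oU f'E Ux) (dmx_comp_jac i oV sps sf Ux (UV Ux)).
Qed.

(** The derivative of [jac ps] along [f] compensates for the inhomogeneous term
    in the transformation law of the Christoffel symbols of the target. *)
Lemma nabla_target (W W' : 'rV[R]_m -> 'rV[R]_n) i x :
  smooth_mx U W -> (forall y, U y -> W' y = W y *m jac ps (f y)) -> U x ->
  nabla H' f' i W' x = nabla H f i W x *m jac ps (f x).
Proof.
move=> sW W'E Ux; have [sps psV HE] := iso; have Vfx := UV Ux.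
have sJ : smooth_mx V (jac ps) by exact: smooth_jac.
have sP : smooth_mx U (fun y => jac ps (f y)).
  exact: smooth_mx_comp oU oV sJ sf UV.
rewrite !nablaE dmx_target // f'E // W'E // (dmx_eq i oU W'E Ux).
rewrite (dmxM i oU sW sP Ux) mulmxDl -addrA; congr (_ + _).
rewrite (dmx_comp i oV sJ sf Ux Vfx) bil_comp bil_mulmx.
have -> : W x *m (\sum_b dmx i f x 0 b *: dmx b (jac ps) (f x)) =
    bil (fun b c => dmx b (dmx c ps) (f x)) (dmx i f x) (W x).
  rewrite mulmx_sumr; apply: eq_bigr => b _.
  rewrite -scalemxAr mulmx_sum_row scaler_sumr; apply: eq_bigr => c _.
  rewrite scalerA; congr (_ *: _); apply/rowP => a; rewrite !mxE.
  by congr (pd b _ _); apply/funext => y; rewrite !mxE.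
rewrite -bil_add; apply: eq_bil => b c.
by rewrite (gamma_isometry oV oV' mH mH' iso b c Vfx) nablaE !jac_row.
Qed.

Lemma covdiv_target G (al al' : 'I_m -> 'rV[R]_m -> 'rV[R]_n) x :
  (forall j, smooth_mx U (al j)) ->
  (forall j y, U y -> al' j y = al j y *m jac ps (f y)) -> U x ->
  covdiv id id G H' f' al' x = covdiv id id G H f al x *m jac ps (f x).
Proof.
move=> sal alE Ux; rewrite /covdiv /trg mulmx_suml; apply: eq_bigr => i _.
rewrite mulmx_suml; apply: eq_bigr => j _.
rewrite -scalemxAl mulmxBl mulmx_suml (nabla_target i (sal j) (alE j) Ux).
congr (_ *: (_ - _)); apply: eq_bigr => k _.
by rewrite alE // scalemxAl.
Qed.

End Target.

Section Source.
Context m n (U U' : set 'rV[R]_m) (V : set 'rV[R]_n)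
  (G G' : 'rV[R]_m -> 'M[R]_m) (th : 'rV[R]_m -> 'rV[R]_m)
  (H : 'rV[R]_n -> 'M[R]_n) (f f' : 'rV[R]_m -> 'rV[R]_n).
Hypotheses (oU : open U) (oU' : open U') (oV : open V) (mG : metric_on U G)
  (mG' : metric_on U' G') (iso : isometry_on U U' G G' th)
  (mH : metric_on V H) (sf' : smooth_mx U' f')
  (UV : forall x, U' x -> V (f' x)) (fE : forall x, U x -> f x = f' (th x)).

Lemma dmx_source (W W' : 'rV[R]_m -> 'rV[R]_n) i x :
  smooth_mx U' W' -> (forall y, U y -> W y = W' (th y)) -> U x ->
  dmx i W x = \sum_a jac th x i a *: dmx a W' (th x).
Proof.
move=> sW WE Ux; have [sth thU _] := iso.
rewrite (dmx_eq i oU WE Ux) (dmx_comp i oU' sW sth Ux (thU x Ux)).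
by apply: eq_bigr => a _; rewrite jacE.
Qed.

Lemma nabla_source (W W' : 'rV[R]_m -> 'rV[R]_n) i x :
  smooth_mx U' W' -> (forall y, U y -> W y = W' (th y)) -> U x ->
  nabla H f i W x = \sum_a jac th x i a *: nabla H f' a W' (th x).
Proof.
move=> sW WE Ux; rewrite nablaE (dmx_source i sW WE Ux) (dmx_source i sf' fE Ux).
rewrite fE // WE // bil_suml -big_split; apply: eq_bigr => a _.
by rewrite nablaE scalerDr.
Qed.

(** The first sum is not tensorial. It is symmetric in [i] and [j], hence absent
    from commutators, and it cancels with the Christoffel symbols of the source
    in [covdiv_source]. *)
Lemma nabla_form_source (al al' : 'I_m -> 'rV[R]_m -> 'rV[R]_n) i j x :
  (forall b, smooth_mx U' (al' b)) ->
  (forall k y, U y -> al k y = \sum_b jac th y k b *: al' b (th y)) -> U x ->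
  nabla H f i (al j) x =
    \sum_b dmx i (dmx j th) x 0 b *: al' b (th x) +
    \sum_a \sum_b (jac th x i a * jac th x j b) *: nabla H f' a (al' b) (th x).
Proof.
move=> sal alE Ux; have [sth thU _] := iso.
rewrite (nabla_eq H i oU (fun y _ => erefl (f y)) (alE j) Ux).
have sJ b : smooth U (fun y => jac th y j b) by exact: smooth_jac.
have sA b : smooth_mx U (fun y => al' b (th y)).
  exact: smooth_mx_comp oU oU' (sal b) sth thU.
rewrite (nabla_leibniz H f i oU sJ sA Ux); congr (_ + _).
  apply: eq_bigr => b _; congr (_ *: _); rewrite mxE; congr (pd i _ x).
  by apply/funext => y; rewrite jacE.
rewrite exchange_big /=; apply: eq_bigr => b _.
rewrite (nabla_source i (sal b) (fun y _ => erefl _) Ux) scaler_sumr.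
by apply: eq_bigr => a _; rewrite scalerA mulrC.
Qed.

Lemma covdiv_source (al al' : 'I_m -> 'rV[R]_m -> 'rV[R]_n) x :
  (forall b, smooth_mx U' (al' b)) ->
  (forall k y, U y -> al k y = \sum_b jac th y k b *: al' b (th y)) -> U x ->
  covdiv id id G H f al x = covdiv id id G' H f' al' (th x).
Proof.
move=> sal alE Ux; have [sth thU GE] := iso.
rewrite /covdiv; apply: (trg_congr (metric_unit mG Ux) (GE x Ux)) => i j /=.
have -> : \sum_k christoffel G x k i j *: al k x =
    \sum_b (gamma G x i j *m jac th x) 0 b *: al' b (th x).
  under eq_bigr => k _ do rewrite alE // scaler_sumr.
  rewrite exchange_big /=; apply: eq_bigr => b _.
  rewrite mxE scaler_suml; apply: eq_bigr => k _.
  by rewrite scalerA [gamma _ _ _ _ _ _]mxE.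
rewrite (gamma_isometry oU oU' mG mG' iso i j Ux) [nabla G' _ _ _ _]nablaE.
rewrite (nabla_form_source i j sal alE Ux).
under [X in _ + _ - X]eq_bigr => b _ do rewrite mxE scalerDl.
rewrite big_split /= opprD addrACA subrr add0r -!jac_row /bil.
under [X in _ = X]eq_bigr => a _.
  under eq_bigr => b _ do rewrite scalerBr.
  rewrite big_split /= sumrN; over.
rewrite sumrB; congr (_ - _).
under eq_bigr => c _ do rewrite summxE scaler_suml.
rewrite exchange_big /=; apply: eq_bigr => a _.
under [RHS]eq_bigr => b _ do rewrite scaler_sumr.
rewrite [RHS]exchange_big /=; apply: eq_bigr => c _.
rewrite summxE scaler_suml; apply: eq_bigr => b _.
by rewrite scalerA !mxE.
Qed.

End Source.

End ChangeOfCoordinates.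

(** * Curvature as a commutator of covariant derivatives *)

Section Densities.
Context {R : realType}.
Implicit Types m n p q : nat.

Lemma dmx_bil m n p (U : set 'rV[R]_m) (B : 'rV[R]_m -> 'I_n -> 'I_n -> 'rV[R]_p)
    (u v : 'rV[R]_m -> 'rV[R]_n) i x :
  open U -> (forall b c, smooth_mx U (fun y => B y b c)) ->
  smooth_mx U u -> smooth_mx U v -> U x ->
  dmx i (fun y => bil (B y) (u y) (v y)) x =
  bil (fun b c => dmx i (fun y => B y b c) x) (u x) (v x)
  + bil (B x) (dmx i u x) (v x) + bil (B x) (u x) (dmx i v x).
Proof.
move=> oU sB su sv Ux.
have suv b c : smooth U (fun y => u y 0 b * v y 0 c) by apply: smooth_mul.
rewrite /bil (@dmx_sum _ _ _ _ U) //; last first.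
  by move=> b; apply: smooth_mx_sum => // c; apply: smooth_mxZ.
rewrite -!big_split; apply: eq_bigr => b _ /=.
rewrite (@dmx_sum _ _ _ _ U) //; last by move=> c; apply: smooth_mxZ.
rewrite -!big_split; apply: eq_bigr => c _ /=.
rewrite (dmxZ i (suv b c) (sB b c) Ux) (pd_mul i (su 0 b) (sv 0 c) Ux).
by rewrite scalerDl ![dmx _ _ _ _ _]mxE [LHS]addrC [LHS]addrA.
Qed.

Lemma bil_sumB n p (I : finType) (g : I -> R)
    (B : I -> 'I_n -> 'I_n -> 'rV[R]_p) u v :
  bil (fun b c => \sum_a g a *: B a b c) u v = \sum_a g a *: bil (B a) u v.
Proof.
under [RHS]eq_bigr => a _ do rewrite scaler_sumr.
rewrite [RHS]exchange_big; apply: eq_bigr => b _ /=.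
under [RHS]eq_bigr => a _ do rewrite scaler_sumr.
rewrite [RHS]exchange_big; apply: eq_bigr => c _ /=.
by rewrite scaler_sumr; apply: eq_bigr => a _; rewrite !scalerA mulrC.
Qed.

Lemma covdE n (H : 'rV[R]_n -> 'M[R]_n) X Y y :
  covd H X Y y = \sum_b X y 0 b *: dmx b Y y + bil (gamma H y) (X y) (Y y).
Proof.
apply/rowP => a; rewrite mxE [RHS]mxE !summxE; congr (_ + _).
  by apply: eq_bigr => b _; rewrite !mxE.
apply: eq_bigr => b _; rewrite summxE; apply: eq_bigr => c _.
by rewrite [RHS]mxE [gamma _ _ _ _ _ _]mxE -mulrA mulrC.
Qed.

Lemma lie_bracket_cst n (u v : 'rV[R]_n) :
  lie_bracket (fun=> u) (fun=> v) = fun=> 0.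
Proof.
apply/funext => y; apply/rowP => a; rewrite !mxE big1 // => b _.
by rewrite !pd_cst !mulr0 subrr.
Qed.

Lemma covd_cst n (H : 'rV[R]_n -> 'M[R]_n) (v w : 'rV[R]_n) :
  covd H (fun=> v) (fun=> w) = fun y => bil (gamma H y) v w.
Proof.
apply/funext => y; rewrite covdE big1 ?add0r // => b _.
by rewrite dmx_cst scaler0.
Qed.

Section CurvatureCommutator.
Context m n (U : set 'rV[R]_m) (V : set 'rV[R]_n) (H : 'rV[R]_n -> 'M[R]_n)
  (f W : 'rV[R]_m -> 'rV[R]_n).
Hypotheses (oU : open U) (oV : open V) (mH : metric_on V H)
  (sf : smooth_mx U f) (UV : forall x, U x -> V (f x)) (sW : smooth_mx U W).

Let dgamma (y : 'rV[R]_n) a : 'I_n -> 'I_n -> 'rV[R]_n :=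
  fun b c => dmx a (fun z => gamma H z b c) y.

Lemma covd_covd_cst (u v w : 'rV[R]_n) y : V y ->
  covd H (fun=> u) (covd H (fun=> v) (fun=> w)) y =
  \sum_a u 0 a *: bil (dgamma y a) v w + bil (gamma H y) u (bil (gamma H y) v w).
Proof.
move=> Vy; rewrite covdE covd_cst; congr (_ + _); apply: eq_bigr => a _.
have sc (c : 'rV[R]_n) : smooth_mx V (fun=> c) by move=> i j; exact: smooth_cst.
rewrite (dmx_bil a oV (fun b c => smooth_gamma b c oV mH) (sc v) (sc w) Vy).
by rewrite !dmx_cst bil0l linear0 !addr0.
Qed.

(** The part of the right-hand side that is not symmetric in [i] and [j] consists
    of curvature terms. *)
Lemma nabla_nabla i j x : U x ->
  nabla H f i (nabla H f j W) x =
  dmx i (dmx j W) x +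
  (\sum_a dmx i f x 0 a *: bil (dgamma (f x) a) (dmx j f x) (W x)
   + bil (gamma H (f x)) (dmx i (dmx j f) x) (W x)
   + bil (gamma H (f x)) (dmx j f x) (dmx i W x)) +
  (bil (gamma H (f x)) (dmx i f x) (dmx j W x) +
   bil (gamma H (f x)) (dmx i f x) (bil (gamma H (f x)) (dmx j f x) (W x))).
Proof.
move=> Ux; rewrite nablaE nablaE bilDr; congr (_ + _).
have sG b c : smooth_mx U (fun y => gamma H (f y) b c).
  exact: (smooth_mx_comp (A := fun y => gamma H y b c) oU oV (smooth_gamma b c oV mH) sf UV).
have sdf := smooth_dmx j oU sf; have sdW := smooth_dmx j oU sW.
have -> : nabla H f j W =
    fun y => dmx j W y + bil (gamma H (f y)) (dmx j f y) (W y).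
  by apply/funext => y; rewrite nablaE.
rewrite (dmxD i sdW (smooth_bil oU sG sdf sW) Ux).
rewrite (dmx_bil i oU sG sdf sW Ux); congr (_ + (_ + _ + _)).
rewrite -bil_sumB; apply: eq_bil => b c.
by rewrite (dmx_comp i oV (smooth_gamma b c oV mH) sf Ux (UV Ux)).
Qed.

(** Coordinate fields commute, so there is no bracket term; in this form the
    curvature inherits smoothness and transformation rules from [nabla]. *)
Lemma curv_commutator i j x : U x ->
  curv H (f x) (dcoord f i x) (dcoord f j x) (W x) =
  nabla H f i (nabla H f j W) x - nabla H f j (nabla H f i W) x.
Proof.
move=> Ux; rewrite !dcoordE /curv /curv_field lie_bracket_cst.
rewrite (covdE H (fun=> 0)) bil0l big1 => [|b _]; last by rewrite mxE scale0r.
rewrite addr0 subr0 !covd_covd_cst; [|exact: UV..].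
rewrite !nabla_nabla //.
rewrite (dmxC j i oU sW Ux) (dmxC j i oU sf Ux).
have arith (a s p p' c c' q q' : 'rV[R]_n) :
  c + q - (c' + q') = a + (c + s + p') + (p + q) - (a + (c' + s + p) + (p' + q')).
  by apply/rowP => k; rewrite !mxE; ring.
exact: arith.
Qed.

End CurvatureCommutator.
End Densities.

(** * Positivity of traces *)

Section FrameSum.
Context {R : realType}.
Implicit Types m n p q : nat.

Lemma inner_suml n (A : 'M[R]_n) (I : finType) (a : I -> R) (u : I -> 'rV[R]_n) v :
  inner A (\sum_i a i *: u i) v = \sum_i a i * inner A (u i) v.
Proof.
rewrite /inner mulmx_suml mulmx_suml summxE; apply: eq_bigr => i _.
by rewrite -!scalemxAl mxE.
Qed.

Lemma inner_sumr n (A : 'M[R]_n) (I : finType) (a : I -> R) u (v : I -> 'rV[R]_n) :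
  inner A u (\sum_i a i *: v i) = \sum_i a i * inner A u (v i).
Proof.
rewrite /inner linear_sum mulmx_sumr summxE; apply: eq_bigr => i _ /=.
by rewrite linearZ /= -scalemxAr mxE.
Qed.

Lemma inner_mulmx n (A J : 'M[R]_n) u v :
  inner A (u *m J) (v *m J) = inner (J *m A *m J^T) u v.
Proof. by rewrite /inner trmx_mul !mulmxA. Qed.

Lemma inner0l n (A : 'M[R]_n) v : inner A 0 v = 0.
Proof. by rewrite /inner !mul0mx mxE. Qed.

Lemma inner_ge0 n (A : 'M[R]_n) v :
  (forall w : 'rV[R]_n, w != 0 -> 0 < inner A w w) -> 0 <= inner A v v.
Proof.
by move=> pA; have [->|/pA/ltW //] := eqVneq v 0; rewrite inner0l.
Qed.

(** Gram-Schmidt, as an induction on the size through the Schur complement. *)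
Lemma orthonormal_frame m (A : 'M[R]_m) :
  A^T = A -> (forall v : 'rV[R]_m, v != 0 -> 0 < inner A v v) ->
  exists E : 'M[R]_m, E *m A *m E^T = 1%:M.
Proof.
elim: m A => [|m IH] A tA pA; first by exists 0; apply/matrixP => -[].
pose A1 : 'M[R]_(1 + m) := A.
pose a := ulsubmx A1; pose b := dlsubmx A1; pose d := drsubmx A1.
have tA1 : A1^T = A1 by exact: tA.
have pA1 (v : 'rV[R]_(1 + m)) : v != 0 -> 0 < inner A1 v v by exact: pA.
have AE : A1 = block_mx a b^T b d by rewrite -[LHS]submxK /b trmx_dlsub tA1.
have td : d^T = d by rewrite /d trmx_drsub tA1.
(* The pivot; c eliminates the first column below it and C is the complement. *)
pose a0 := a 0 0.
have aE : a = a0%:M by rewrite [LHS]mx11_scalar.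
have a0_gt0 : 0 < a0.
  have v0 : row_mx (1%:M : 'M[R]_1) (0 : 'M[R]_(1, m)) != 0.
    apply/eqP => /(congr1 (fun B => lsubmx B)); rewrite row_mxKl linear0.
    by move=> /matrixP/(_ 0 0); rewrite !mxE /= => /eqP; rewrite oner_eq0.
  have := pA1 _ v0; rewrite /inner AE mul_row_block !mul1mx !mul0mx !addr0.
  by rewrite tr_row_mx mul_row_col trmx1 trmx0 mulmx1 mulmx0 addr0.
have a0_neq0 : a0 != 0 by rewrite gt_eqF.
pose c : 'cV[R]_m := a0^-1 *: b.
pose L : 'M[R]_(1 + m) := block_mx 1%:M 0 (- c) 1%:M.
pose C := d - c *m b^T.
have ca : c *m a = b by rewrite aE mul_mx_scalar scalerA divff // scale1r.
have LAL : L *m A1 *m L^T = block_mx a 0 0 C.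
  rewrite AE /L mulmx_block tr_block_mx mulmx_block !trmx1 !trmx0.
  rewrite !mul1mx !mul0mx !mulmx0 !mulmx1 !addr0 mulNmx ca addNr mul0mx add0r.
  rewrite linearN /= mulmxN; congr block_mx.
    by rewrite /c linearZ /= -scalemxAr aE mul_scalar_mx scalerA mulVf // scale1r addNr.
  by rewrite mulNmx addrC.
have tC : C^T = C.
  by rewrite /C /c linearB /= td trmx_mul trmxK linearZ /= -scalemxAr -scalemxAl.
have pC v : v != 0 -> 0 < inner C v v.
  move=> v0.
  have -> : inner C v v = inner A1 (row_mx 0 v *m L) (row_mx 0 v *m L).
    rewrite inner_mulmx LAL /inner mul_row_block tr_row_mx !mul0mx !add0r mulmx0.
    by rewrite mul_row_col mul0mx add0r.
  apply: pA1; rewrite mul_row_block mul0mx add0r mulmx1 mulmx0 add0r.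
  apply: contra v0 => /eqP/(congr1 (fun B : 'M[R]_(1, 1 + m) => rsubmx B)).
  by rewrite row_mxKr linear0 => ->.
have [E EE] := IH C tC pC; pose s := (Num.sqrt a0)^-1.
have saE : s * a0 * s = 1.
  rewrite -[in X in _ * X * _](sqr_sqrtr (ltW a0_gt0)) /s expr2.
  by field; rewrite gt_eqF // sqrtr_gt0.
suff [F FE] : exists F : 'M[R]_(1 + m), F *m A1 *m F^T = 1%:M by exists F.
exists (block_mx s%:M 0 0 E *m L).
rewrite trmx_mul mulmxA -(mulmxA _ L A1) -(mulmxA _ (L *m A1)) LAL.
rewrite tr_block_mx !trmx0 mulmx_block !mul0mx !mulmx0 !addr0 add0r.
rewrite mulmx_block !mul0mx !mulmx0 !addr0 !add0r EE tr_scalar_mx aE -!scalar_mxM saE.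
by rewrite -scalar_mx_block.
Qed.

Lemma trg_ge0 m (A : 'M[R]_m) (B : 'I_m -> 'I_m -> R) :
  A^T = A -> (forall v : 'rV[R]_m, v != 0 -> 0 < inner A v v) ->
  (forall v : 'I_m -> R, 0 <= \sum_i \sum_j v i * v j * B i j) ->
  0 <= trg (V := R^o) A B.
Proof.
move=> tA pA pB; have [E EE] := orthonormal_frame tA pA.
rewrite (trg_orthonormal _ EE); apply: sumr_ge0 => k _; exact: (pB (E k)).
Qed.

(** In an orthonormal frame this is a sum of squares. Tracing one pair of indices
    first leaves a positive semidefinite form in the other pair. *)
Lemma trg2_inner_ge0 m n (A : 'M[R]_m) (C : 'M[R]_n) (K : 'I_m -> 'I_m -> 'rV[R]_n) :
  A^T = A -> (forall v : 'rV[R]_m, v != 0 -> 0 < inner A v v) ->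
  (forall v : 'rV[R]_n, v != 0 -> 0 < inner C v v) ->
  0 <= trg (V := R^o) A (fun i k => trg (V := R^o) A (fun j l =>
         inner C (K i j) (K k l))).
Proof.
move=> tA pA pC; apply: trg_ge0 => // v.
pose T j := \sum_i v i *: K i j.
suff -> : \sum_i \sum_k v i * v k * trg (V := R^o) A (fun j l =>
    inner C (K i j) (K k l)) = trg (V := R^o) A (fun j l => inner C (T j) (T l)).
  apply: trg_ge0 => // w.
  suff -> : \sum_j \sum_l w j * w l * inner C (T j) (T l) =
     inner C (\sum_j w j *: T j) (\sum_j w j *: T j) by exact: inner_ge0.
  rewrite inner_suml; apply: eq_bigr => j _; rewrite inner_sumr mulr_sumr.
  by apply: eq_bigr => l _; rewrite mulrA.
rewrite /trg.
under eq_bigr => i _.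
  under eq_bigr => k _.
    rewrite mulr_sumr.
    under eq_bigr => j _ do rewrite mulr_sumr.
    over.
  rewrite exchange_big /=.
  under eq_bigr => j _ do rewrite exchange_big /=.
  over.
rewrite exchange_big; apply: eq_bigr => j _ /=.
rewrite exchange_big; apply: eq_bigr => l _ /=.
rewrite inner_suml scaler_sumr; apply: eq_bigr => i _.
rewrite inner_sumr mulr_sumr scaler_sumr; apply: eq_bigr => k _.
by rewrite /GRing.scale /=; ring.
Qed.

End FrameSum.

(** * Densities in coordinates: smoothness, families, target changes *)

Section NaturalDensities.
Context {R : realType}.
Implicit Types m n p q : nat.

Lemma eq_trg m (V : lmodType R) (A : 'M[R]_m) (B B' : 'I_m -> 'I_m -> V) :
  (forall i j, B i j = B' i j) -> trg A B = trg A B'.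
Proof. by move=> BB; apply: eq_bigr => i _; apply: eq_bigr => j _; rewrite BB. Qed.

Definition family_tension q m n (r : 'I_m -> 'I_q) (pi : 'rV[R]_q -> 'rV[R]_m) G
    (H : 'rV[R]_n -> 'M[R]_n) f : 'rV[R]_q -> 'rV[R]_n :=
  covdiv r pi G H f (fun j => dcoord f (r j)).

Definition bienergy_density q m n (r : 'I_m -> 'I_q)
    (pi : 'rV[R]_q -> 'rV[R]_m) G (H : 'rV[R]_n -> 'M[R]_n) f
    (z : 'rV[R]_q) : R :=
  let L := - covdiv r pi G H f
               (fun j => nabla H f (r j) (family_tension r pi G H f)) z in
  inner (H (f z)) L L.

(** R(df_i, df_j) W, by [curv_commutator]. *)
Definition nabla_comm q m n (r : 'I_m -> 'I_q) (H : 'rV[R]_n -> 'M[R]_n) f W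
    (z : 'rV[R]_q) (i j : 'I_m) : 'rV[R]_n :=
  nabla H f (r i) (nabla H f (r j) W) z - nabla H f (r j) (nabla H f (r i) W) z.

Definition curvature_density q m n (r : 'I_m -> 'I_q)
    (pi : 'rV[R]_q -> 'rV[R]_m) G (H : 'rV[R]_n -> 'M[R]_n) f
    (z : 'rV[R]_q) : R :=
  let K := nabla_comm r H f (family_tension r pi G H f) z in
  trg (V := R^o) (G (pi z)) (fun i k => trg (V := R^o) (G (pi z)) (fun j l =>
    inner (H (f z)) (K i j) (K k l))).

Section Smoothness.
Context q m n (W : set 'rV[R]_q) (U : set 'rV[R]_m) (V : set 'rV[R]_n)
  (r : 'I_m -> 'I_q) (pi : 'rV[R]_q -> 'rV[R]_m) (G : 'rV[R]_m -> 'M[R]_m)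
  (H : 'rV[R]_n -> 'M[R]_n) (f : 'rV[R]_q -> 'rV[R]_n).
Hypotheses (oW : open W) (oU : open U) (oV : open V) (mG : metric_on U G)
  (mH : metric_on V H) (spi : smooth_mx W pi) (WU : forall z, W z -> U (pi z))
  (sf : smooth_mx W f) (WV : forall z, W z -> V (f z)).

Lemma smooth_invmx_source i j : smooth W (fun z => invmx (G (pi z)) i j).
Proof.
have [sG _ _] := mG.
have sI : smooth_mx U (fun x => invmx (G x)).
  by apply: smooth_invmx => // x; exact: metric_unit.
exact: (smooth_mx_comp oW oU sI spi WU).
Qed.

Lemma smooth_covdiv (al : 'I_m -> 'rV[R]_q -> 'rV[R]_n) :
  (forall j, smooth_mx W (al j)) -> smooth_mx W (covdiv r pi G H f al).
Proof.
move=> sal; apply: smooth_mx_sum => // i; apply: smooth_mx_sum => // j.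
apply: smooth_mxZ => //; first exact: smooth_invmx_source.
apply: smooth_mxD => //; first exact: smooth_nabla oW oV mH sf WV (sal j).
apply: smooth_mxN => //; apply: smooth_mx_sum => // k.
apply: smooth_mxZ => //.
have sG := smooth_mx_comp oW oU (smooth_gamma i j oU mG) spi WU.
by apply: smooth_eq (sG 0 k) => // z _; rewrite mxE.
Qed.

Lemma smooth_family_tension : smooth_mx W (family_tension r pi G H f).
Proof. by apply: smooth_covdiv => j; rewrite dcoordE; exact: smooth_dmx. Qed.

Lemma smooth_inner (A : 'rV[R]_q -> 'M[R]_n) (u v : 'rV[R]_q -> 'rV[R]_n) :
  smooth_mx W A -> smooth_mx W u -> smooth_mx W v ->
  smooth W (fun z => inner (A z) (u z) (v z)).
Proof.
move=> sA su sv; apply: (smooth_mxM (m := q) oW (smooth_mxM oW su sA)).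
exact: smooth_mx_tr.
Qed.

Lemma smooth_metric_target : smooth_mx W (fun z => H (f z)).
Proof. by have [sH _ _] := mH; exact: smooth_mx_comp oW oV sH sf WV. Qed.

Lemma smooth_bienergy_density : smooth W (bienergy_density r pi G H f).
Proof.
have sL : smooth_mx W (fun z => - covdiv r pi G H f
    (fun j => nabla H f (r j) (family_tension r pi G H f)) z).
  apply: smooth_mxN => //; apply: smooth_covdiv => j.
  exact: smooth_nabla oW oV mH sf WV smooth_family_tension.
exact: (smooth_inner smooth_metric_target sL sL).
Qed.

Lemma smooth_nabla_comm T i j : smooth_mx W T ->
  smooth_mx W (fun z => nabla_comm r H f T z i j).
Proof.
move=> sT; have sN k := smooth_nabla (r k) oW oV mH sf WV sT.
apply: smooth_mxD => //; last apply: smooth_mxN => //;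
  exact: smooth_nabla oW oV mH sf WV (sN _).
Qed.

Lemma smooth_curvature_density : smooth W (curvature_density r pi G H f).
Proof.
rewrite /curvature_density /trg.
apply: smooth_sum => // i _; apply: smooth_sum => // k _.
apply: smooth_mul => //; first exact: smooth_invmx_source.
apply: smooth_sum => // j _; apply: smooth_sum => // l _.
apply: smooth_mul => //; first exact: smooth_invmx_source.
apply: smooth_inner; first exact: smooth_metric_target.
  exact: smooth_nabla_comm smooth_family_tension.
exact: smooth_nabla_comm smooth_family_tension.
Qed.

End Smoothness.

(** A slice [io] that is affine and sends the i-th direction to the direction
    [r i] turns derivatives in M into derivatives in the parameter space. *)
Section Slice.
Context q m n (r : 'I_m -> 'I_q) (pi : 'rV[R]_q -> 'rV[R]_m)
  (io : 'rV[R]_m -> 'rV[R]_q) (G : 'rV[R]_m -> 'M[R]_m)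
  (H : 'rV[R]_n -> 'M[R]_n) (f : 'rV[R]_q -> 'rV[R]_n).
Hypotheses (ioK : forall x, pi (io x) = x)
  (io_line : forall (h : R) (i : 'I_m) x,
     io (h *: delta_mx 0 i + x) = h *: delta_mx 0 (r i) + io x).

Lemma pd_slice (g : 'rV[R]_q -> R) i x :
  pd i (fun y => g (io y)) x = pd (r i) g (io x).
Proof.
rewrite /pd /derive; set g1 := fun h => h^-1 *: _; set g2 := fun h => h^-1 *: _.
suff -> : g1 = g2 by [].
by apply/funext => h; rewrite /g1 /g2 /= io_line.
Qed.

Lemma dmx_slice p s (A : 'rV[R]_q -> 'M[R]_(p, s)) i :
  dmx i (fun y => A (io y)) = fun x => dmx (r i) A (io x).
Proof.
by apply/funext => x; apply/matrixP => a b; rewrite !mxE -pd_slice.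
Qed.

Lemma nabla_slice (T : 'rV[R]_q -> 'rV[R]_n) i :
  nabla H (fun y => f (io y)) i (fun y => T (io y)) =
  fun x => nabla H f (r i) T (io x).
Proof. by apply/funext => x; rewrite !nablaE !dmx_slice. Qed.

Lemma covdiv_slice (al : 'I_m -> 'rV[R]_q -> 'rV[R]_n) :
  covdiv id id G H (fun y => f (io y)) (fun j y => al j (io y)) =
  fun x => covdiv r pi G H f al (io x).
Proof.
apply/funext => x; rewrite /covdiv ioK; apply: eq_bigr => i _.
by apply: eq_bigr => j _; rewrite nabla_slice.
Qed.

Lemma family_tension_slice :
  family_tension id id G H (fun y => f (io y)) = fun x => family_tension r pi G H f (io x).
Proof.
rewrite -covdiv_slice /family_tension; congr (covdiv _ _ _ _ _ _).
by apply/funext => j; rewrite !dcoordE dmx_slice.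
Qed.

Lemma bienergy_density_slice x :
  bienergy_density id id G H (fun y => f (io y)) x =
  bienergy_density r pi G H f (io x).
Proof.
rewrite /bienergy_density family_tension_slice.
move: (family_tension r pi G H f) => T /=.
have nE : (fun j : 'I_m => nabla H (fun y => f (io y)) j (fun y => T (io y))) =
          (fun j y => nabla H f (r j) T (io y)).
  by apply/funext => j; exact: nabla_slice.
by rewrite nE (covdiv_slice (fun j => nabla H f (r j) T)).
Qed.

Lemma curvature_density_slice x :
  curvature_density id id G H (fun y => f (io y)) x =
  curvature_density r pi G H f (io x).
Proof.
rewrite /curvature_density family_tension_slice ioK.
move: (family_tension r pi G H f) => T /=.
have -> // : nabla_comm id H (fun y => f (io y)) (fun y => T (io y)) x =
  nabla_comm r H f T (io x).
apply/funext => i; apply/funext => j; rewrite /nabla_comm /=.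
rewrite (nabla_slice T i) (nabla_slice T j).
by rewrite (nabla_slice (nabla H f (r i) T)) (nabla_slice (nabla H f (r j) T)).
Qed.

End Slice.

Section Target.
Context m n (U : set 'rV[R]_m) (V V' : set 'rV[R]_n)
  (G : 'rV[R]_m -> 'M[R]_m)
  (H H' : 'rV[R]_n -> 'M[R]_n) (ps : 'rV[R]_n -> 'rV[R]_n)
  (f f' : 'rV[R]_m -> 'rV[R]_n).
Hypotheses (oU : open U) (oV : open V) (oV' : open V') (mG : metric_on U G)
  (mH : metric_on V H)
  (mH' : metric_on V' H') (iso : isometry_on V V' H H' ps)
  (sf : smooth_mx U f) (UV : forall x, U x -> V (f x))
  (f'E : forall x, U x -> f' x = ps (f x)).

Let sid : smooth_mx U id.
Proof. by move=> a b k; rewrite [a]ord1; exact: Ck_coord. Qed.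

Let stau : smooth_mx U (family_tension id id G H f).
Proof. exact: smooth_family_tension oU oU oV mG mH sid (fun x Ux => Ux) sf UV. Qed.

Lemma tension_target x : U x ->
  family_tension id id G H' f' x = family_tension id id G H f x *m jac ps (f x).
Proof.
apply: (covdiv_target oU oV oV' mH mH' iso sf UV f'E) => [j|j y Uy].
  by rewrite dcoordE; exact: smooth_dmx.
by rewrite !dcoordE; exact: (dmx_target oU oV iso sf UV f'E).
Qed.

Let nabla_tension_target i x : U x ->
  nabla H' f' i (family_tension id id G H' f') x =
  nabla H f i (family_tension id id G H f) x *m jac ps (f x).
Proof.
by apply: (nabla_target oU oV oV' mH mH' iso sf UV f'E) => //; exact: tension_target.
Qed.

Let snabla i : smooth_mx U (nabla H f i (family_tension id id G H f)).
Proof. exact: smooth_nabla oU oV mH sf UV stau. Qed.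

Lemma bienergy_density_target x : U x ->
  bienergy_density id id G H' f' x = bienergy_density id id G H f x.
Proof.
move=> Ux; rewrite /bienergy_density /=.
rewrite (covdiv_target oU oV oV' mH mH' iso sf UV f'E _ (fun j => snabla j)
  (fun j y Uy => nabla_tension_target j Uy) Ux).
have [_ _ HE] := iso.
by rewrite -mulNmx inner_mulmx f'E // -HE //; exact: UV.
Qed.

Lemma curvature_density_target x : U x ->
  curvature_density id id G H' f' x = curvature_density id id G H f x.
Proof.
move=> Ux; rewrite /curvature_density /=; have [_ _ HE] := iso.
have KE i j : nabla_comm id H' f' (family_tension id id G H' f') x i j =
    nabla_comm id H f (family_tension id id G H f) x i j *m jac ps (f x).
  have N k l := nabla_target oU oV oV' mH mH' iso sf UV f'E k (snabla l)
    (fun y Uy => nabla_tension_target l Uy) Ux.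
  by rewrite /nabla_comm !N mulmxBl.
apply: eq_trg => i k; apply: eq_trg => j l.
by rewrite (KE i j) (KE k l) inner_mulmx f'E // -HE //; exact: UV.
Qed.

End Target.

End NaturalDensities.

(** * Densities in coordinates: vanishing, positivity, source changes *)

Section NaturalDensitiesInvariance.
Context {R : realType}.
Implicit Types m n p q : nat.

Lemma nabla_locally0 m n (U : set 'rV[R]_m) (H : 'rV[R]_n -> 'M[R]_n) f W i x :
  open U -> (forall y, U y -> W y = 0) -> U x -> nabla H f i W x = 0.
Proof.
by move=> oU W0 Ux; rewrite nablaE (dmx_eq i oU W0 Ux) dmx_cst W0 // linear0 addr0.
Qed.

Lemma bienergy_density_eq0 m n (U : set 'rV[R]_m) G (H : 'rV[R]_n -> 'M[R]_n) f x :
  open U -> (forall y, U y -> family_tension id id G H f y = 0) -> U x ->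
  bienergy_density id id G H f x = 0.
Proof.
move=> oU t0 Ux; rewrite /bienergy_density /=.
have N0 j y : U y -> nabla H f j (family_tension id id G H f) y = 0.
  by move=> Uy; exact: nabla_locally0 oU t0 Uy.
have -> : covdiv id id G H f (fun j => nabla H f j (family_tension id id G H f)) x = 0.
  rewrite /covdiv /trg big1 // => i _; rewrite big1 // => j _.
  rewrite (nabla_locally0 H f (id i) oU (N0 j) Ux) big1 ?subr0 ?scaler0 // => k _.
  by rewrite N0 // scaler0.
by rewrite oppr0 inner0l.
Qed.

Lemma curvature_density_eq0 m n (U : set 'rV[R]_m) G (H : 'rV[R]_n -> 'M[R]_n) f x :
  open U -> (forall y, U y -> family_tension id id G H f y = 0) -> U x ->
  curvature_density id id G H f x = 0.
Proof.
move=> oU t0 Ux; rewrite /curvature_density.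
have N0 j y : U y -> nabla H f j (family_tension id id G H f) y = 0.
  by move=> Uy; exact: nabla_locally0 oU t0 Uy.
have K0 i j : nabla_comm id H f (family_tension id id G H f) x i j = 0.
  rewrite /nabla_comm (nabla_locally0 H f (id i) oU (N0 j) Ux).
  by rewrite (nabla_locally0 H f (id j) oU (N0 i) Ux) subr0.
rewrite /trg big1 // => i _; rewrite big1 // => k _.
rewrite big1 ?scaler0 // => j _; rewrite big1 // => l _.
by rewrite (K0 i j) inner0l scaler0.
Qed.

Lemma bienergy_density_ge0 m n (U : set 'rV[R]_m) (V : set 'rV[R]_n) G H f x :
  metric_on U G -> metric_on V H -> U x -> V (f x) ->
  0 <= bienergy_density id id G H f x.
Proof. by move=> mG [_ _ pH] Ux Vx; apply: inner_ge0 (pH _ Vx). Qed.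

Lemma curvature_density_ge0 m n (U : set 'rV[R]_m) (V : set 'rV[R]_n) G H f x :
  metric_on U G -> metric_on V H -> U x -> V (f x) ->
  0 <= curvature_density id id G H f x.
Proof.
by move=> [_ tG pG] [_ _ pH] Ux Vx; exact: (trg2_inner_ge0 _ (tG _ Ux) (pG _ Ux) (pH _ Vx)).
Qed.

Section Source.
Context m n (U U' : set 'rV[R]_m) (V : set 'rV[R]_n)
  (G G' : 'rV[R]_m -> 'M[R]_m) (th : 'rV[R]_m -> 'rV[R]_m)
  (H : 'rV[R]_n -> 'M[R]_n) (f f' : 'rV[R]_m -> 'rV[R]_n).
Hypotheses (oU : open U) (oU' : open U') (oV : open V) (mG : metric_on U G)
  (mG' : metric_on U' G') (iso : isometry_on U U' G G' th)
  (mH : metric_on V H) (sf' : smooth_mx U' f')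
  (UV : forall x, U' x -> V (f' x)) (fE : forall x, U x -> f x = f' (th x)).

Let sid : smooth_mx U' id.
Proof. by move=> a b k; rewrite [a]ord1; exact: Ck_coord. Qed.

Let stau : smooth_mx U' (family_tension id id G' H f').
Proof. exact: smooth_family_tension oU' oU' oV mG' mH sid (fun x Ux => Ux) sf' UV. Qed.

Lemma tension_source x : U x ->
  family_tension id id G H f x = family_tension id id G' H f' (th x).
Proof.
move=> Ux; apply: (covdiv_source H oU oU' mG mG' iso sf' fE _ _ Ux) => [j|j y Uy].
  by rewrite dcoordE; exact: smooth_dmx.
rewrite !dcoordE (dmx_source oU oU' iso j sf' fE Uy).
by apply: eq_bigr => a _; rewrite dcoordE.
Qed.

Let nabla_tension_source i x : U x ->
  nabla H f i (family_tension id id G H f) x =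
  \sum_a jac th x i a *: nabla H f' a (family_tension id id G' H f') (th x).
Proof.
exact: (nabla_source H oU oU' iso sf' fE i stau (fun y Uy => tension_source Uy)).
Qed.

Let snabla i : smooth_mx U' (nabla H f' i (family_tension id id G' H f')).
Proof. exact: smooth_nabla oU' oV mH sf' UV stau. Qed.

Lemma bienergy_density_source x : U x ->
  bienergy_density id id G H f x = bienergy_density id id G' H f' (th x).
Proof.
move=> Ux; rewrite /bienergy_density /= (fE Ux).
by rewrite (covdiv_source H oU oU' mG mG' iso sf' fE (fun j => snabla j)
  (fun j y Uy => nabla_tension_source j Uy) Ux).
Qed.

Lemma curvature_density_source x : U x ->
  curvature_density id id G H f x = curvature_density id id G' H f' (th x).
Proof.
move=> Ux; rewrite /curvature_density /= (fE Ux).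
have [sth _ GE] := iso; set J := jac th x.
set K := nabla_comm _ _ _ _ x; set K' := nabla_comm _ _ _ _ (th x).
pose T i b := \sum_a J i a *: K' a b.
have KE i j : K i j = \sum_b J j b *: T i b.
  have N k l := nabla_form_source H oU oU' iso sf' fE k l (fun j => snabla j)
    (fun j y Uy => nabla_tension_source j Uy) Ux.
  rewrite /K /nabla_comm (N i j) (N j i) (dmxC j i oU sth Ux).
  rewrite opprD addrACA subrr add0r -/J.
  rewrite [X in X - _]exchange_big -sumrB; apply: eq_bigr => b _ /=.
  rewrite /T scaler_sumr -sumrB; apply: eq_bigr => a _.
  by rewrite scalerA /K' /nabla_comm scalerBr (mulrC (J i a)).
have -> : trg (V := R^o) (G' (th x)) (fun i k =>
    trg (V := R^o) (G' (th x)) (fun j l => inner (H (f' (th x))) (K' i j) (K' k l))) =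
  trg (V := R^o) (G x) (fun i k =>
    trg (V := R^o) (G' (th x)) (fun b d => inner (H (f' (th x))) (T i b) (T k d))).
  apply/esym/(trg_congr (metric_unit mG Ux) (GE x Ux)) => i k.
  rewrite /trg.
  under [RHS]eq_bigr => a _.
    under eq_bigr => c _.
      rewrite scaler_sumr.
      under eq_bigr => b _ do rewrite scaler_sumr.
      over.
    rewrite exchange_big /=.
    under eq_bigr => b _ do rewrite exchange_big /=.
    over.
  rewrite [RHS]exchange_big; apply: eq_bigr => b _ /=.
  rewrite [RHS]exchange_big; apply: eq_bigr => d _ /=.
  rewrite inner_suml scaler_sumr; apply: eq_bigr => a _.
  rewrite inner_sumr mulr_sumr scaler_sumr; apply: eq_bigr => c _.
  by rewrite /GRing.scale /=; ring.
apply: eq_trg => i k.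
apply: (trg_congr (metric_unit mG Ux) (GE x Ux)) => j l.
rewrite (KE i j) (KE k l) inner_suml; apply: eq_bigr => b _.
rewrite inner_sumr mulr_sumr; apply: eq_bigr => d _.
by rewrite /GRing.scale /= mulrA.
Qed.

End Source.
End NaturalDensitiesInvariance.

(** The argument on manifolds is the same for both densities, so it is carried out
    for an abstract one. Smoothness and restriction to slices concern families
    over M, with [r] and [pi] as in [covdiv], because derivatives in time are
    needed; invariance under changes of charts concerns single maps. *)
Record natural_density (R : realType) (m n : nat)
    (de : forall q, ('I_m -> 'I_q) -> ('rV[R]_q -> 'rV[R]_m) ->
       ('rV[R]_m -> 'M[R]_m) -> ('rV[R]_n -> 'M[R]_n) ->
       ('rV[R]_q -> 'rV[R]_n) -> 'rV[R]_q -> R) : Prop := NaturalDensity {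
  density_smooth : forall q (W : set 'rV[R]_q) (U : set 'rV[R]_m)
    (V : set 'rV[R]_n) r pi G H f,
    open W -> open U -> open V -> metric_on U G -> metric_on V H ->
    smooth_mx W pi -> (forall z, W z -> U (pi z)) -> smooth_mx W f ->
    (forall z, W z -> V (f z)) -> smooth W (de q r pi G H f);
  density_slice : forall q r pi (io : 'rV[R]_m -> 'rV[R]_q) G H f,
    (forall x, pi (io x) = x) ->
    (forall (h : R) (i : 'I_m) x,
      io (h *: delta_mx 0 i + x) = h *: delta_mx 0 (r i) + io x) ->
    forall x, de m id id G H (fun y => f (io y)) x = de q r pi G H f (io x);
  density_target : forall (U : set 'rV[R]_m) (V V' : set 'rV[R]_n) G H H' ps f f',
    open U -> open V -> open V' -> metric_on U G -> metric_on V H ->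
    metric_on V' H' -> isometry_on V V' H H' ps -> smooth_mx U f ->
    (forall x, U x -> V (f x)) -> (forall x, U x -> f' x = ps (f x)) ->
    forall x, U x -> de m id id G H' f' x = de m id id G H f x;
  density_source : forall (U U' : set 'rV[R]_m) (V : set 'rV[R]_n) G G' th H f f',
    open U -> open U' -> open V -> metric_on U G -> metric_on U' G' ->
    isometry_on U U' G G' th -> metric_on V H -> smooth_mx U' f' ->
    (forall x, U' x -> V (f' x)) -> (forall x, U x -> f x = f' (th x)) ->
    forall x, U x -> de m id id G H f x = de m id id G' H f' (th x);
  density_eq0 : forall (U : set 'rV[R]_m) G H f x, open U ->
    (forall y, U y -> family_tension id id G H f y = 0) -> U x ->
    de m id id G H f x = 0;
  density_ge0 : forall (U : set 'rV[R]_m) (V : set 'rV[R]_n) G H f x,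
    metric_on U G -> metric_on V H -> U x -> V (f x) ->
    0 <= de m id id G H f x }.

Lemma natural_bienergy_density (R : realType) m n :
  natural_density (fun q => @bienergy_density R q m n).
Proof.
split.
- by move=> *; apply: smooth_bienergy_density; eassumption.
- by move=> *; apply: bienergy_density_slice; eassumption.
- move=> U V V' G H H' ps f f' oU oV oV' mG mH mH' iso sf UV fE x Ux.
  exact: (bienergy_density_target oU oV oV' mG mH mH' iso sf UV fE).
- move=> U U' V G G' th H f f' oU oU' oV mG mG' iso mH sf UV fE x Ux.
  exact: (bienergy_density_source oU oU' oV mG mG' iso mH sf UV fE).
- by move=> *; apply: bienergy_density_eq0; eassumption.
- by move=> *; apply: bienergy_density_ge0; eassumption.
Qed.

Lemma natural_curvature_density (R : realType) m n :
  natural_density (fun q => @curvature_density R q m n).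
Proof.
split.
- by move=> *; apply: smooth_curvature_density; eassumption.
- by move=> *; apply: curvature_density_slice; eassumption.
- move=> U V V' G H H' ps f f' oU oV oV' mG mH mH' iso sf UV fE x Ux.
  exact: (curvature_density_target oU oV oV' mG mH mH' iso sf UV fE).
- move=> U U' V G G' th H f f' oU oU' oV mG mG' iso mH sf UV fE x Ux.
  exact: (curvature_density_source oU oU' oV mG mG' iso mH sf UV fE).
- by move=> *; apply: curvature_density_eq0; eassumption.
- by move=> *; apply: curvature_density_ge0; eassumption.
Qed.

(** * Densities on manifolds *)

(* [coord] also denotes coordinates with respect to a basis of a vector space;
   below it is the coordinate map of a chart. *)
Local Notation coord := Defs.coord.

Section OpenPreimage.

Lemma open_preimage_in (S T : topologicalType) (U : set S) (f : S -> T)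
    (A : set T) :
  open U -> (forall x, U x -> {for x, continuous f}) -> open A ->
  open (U `&` f @^-1` A).
Proof.
move=> oU cf oA; rewrite openE => x [Ux Afx].
apply: filterI; first exact: open_nbhs_nbhs.
by apply: (cf x Ux); exact: open_nbhs_nbhs.
Qed.

End OpenPreimage.

Section Charts.
Context {R : realType}.
Implicit Types m n : nat.

Lemma smooth_mx_row m p q (U : set 'rV[R]_m) (A : 'rV[R]_m -> 'M[R]_(p, q)) :
  open U -> (forall i, smooth_on U (fun x => row i (A x))) -> smooth_mx U A.
Proof.
move=> oU sA i j; apply: smooth_eq (sA i j) => // x _; by rewrite mxE.
Qed.

Lemma metric_on_chart m (M : riemannian R m) (c : chart_index M) :
  metric_on (cod (chart_of M c)) (metric M c).
Proof.
split.
- by apply: smooth_mx_row; [exact: cod_open|exact: metric_smooth].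
- by move=> x cx; exact: Defs.metric_sym cx.
- by move=> x cx v v0; exact: Defs.metric_pos cx v v0.
Qed.

Lemma overlap_open m (M : manifold R m) (c c' : chart_index M) :
  open (overlap c c').
Proof.
apply: open_preimage_in; [exact: cod_open|exact: param_continuous|exact: dom_open].
Qed.

Lemma overlap_transition m (M : manifold R m) (c c' : chart_index M) x :
  overlap c c' x -> overlap c' c (transition c c' x).
Proof.
move=> [cx c'x]; split; first exact: coord_cod.
by rewrite /preimage /= /transition /= coordK //; exact: param_dom.
Qed.

Lemma transition_isometry m (M : riemannian R m) (c c' : chart_index M) :
  isometry_on (overlap c c') (overlap c' c) (metric M c) (metric M c')
    (transition c c').
Proof.
split.
- by apply/smooth_onP; exact: transition_smooth.
- exact: overlap_transition.
- exact: metric_compat.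
Qed.

Lemma isometry_on_sub m (U U' A A' : set 'rV[R]_m) G G' th :
  A `<=` U -> (forall x, A x -> A' (th x)) ->
  isometry_on U U' G G' th -> isometry_on A A' G G' th.
Proof.
move=> AU thA [sth _ GE]; split => //; first exact: smooth_mx_sub AU sth.
by move=> x /AU; exact: GE.
Qed.

Lemma metric_on_overlap m (M : riemannian R m) (c c' : chart_index M) :
  metric_on (overlap c c') (metric M c).
Proof. by apply: metric_on_sub (metric_on_chart c) => x []. Qed.

End Charts.

Section Maps.
Context {R : realType} (m n : nat) (M : riemannian R m) (N : riemannian R n).
Implicit Types (chi : M -> N) (c : chart_index M) (d : chart_index N).

Lemma local_dom_open chi c d : continuous chi -> open (local_dom chi c d).
Proof.
move=> cchi; apply: open_preimage_in; [exact: cod_open| |exact: dom_open].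
move=> x cx; apply: continuous_comp; first exact: param_continuous.
exact: cchi.
Qed.

Lemma local_rep_cod chi c d x : local_dom chi c d x ->
  cod (chart_of N d) (local_rep chi c d x).
Proof. by move=> [_ dx]; exact: coord_cod. Qed.

Lemma local_rep_overlap chi c d d' x :
  local_dom chi c d x -> local_dom chi c d' x ->
  overlap d d' (local_rep chi c d x).
Proof.
move=> [cx dx] [_ d'x]; split; first exact: coord_cod.
by rewrite /preimage /= /local_rep /= coordK.
Qed.

Lemma local_rep_target chi c d d' x : local_dom chi c d x ->
  local_rep chi c d' x = transition d d' (local_rep chi c d x).
Proof. by move=> [cx dx]; rewrite /local_rep /transition /= coordK. Qed.

Definition coord_dens (de : forall q, ('I_m -> 'I_q) ->
    ('rV[R]_q -> 'rV[R]_m) -> ('rV[R]_m -> 'M[R]_m) -> ('rV[R]_n -> 'M[R]_n) ->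
    ('rV[R]_q -> 'rV[R]_n) -> 'rV[R]_q -> R) chi c d (x : 'rV[R]_m) : R :=
  de m id id (metric M c) (metric N d) (local_rep chi c d) x.

Definition coord_tension chi c d : 'rV[R]_m -> 'rV[R]_n :=
  family_tension id id (metric M c) (metric N d) (local_rep chi c d).

Section TargetChart.
Context chi c d d'.
Hypothesis schi : smooth_map chi.
Let U := local_dom chi c d `&` local_dom chi c d'.

Let oU : open U.
Proof. by apply: openI; apply: local_dom_open; case: schi. Qed.

Let mU : metric_on U (metric M c).
Proof. by apply: metric_on_sub (metric_on_chart c) => x [[]]. Qed.

Let sf : smooth_mx U (local_rep chi c d).
Proof.
have [_ /(_ c d)/smooth_onP] := schi; apply: smooth_mx_sub; exact: subIsetl.
Qed.

Let UV x : U x -> overlap d d' (local_rep chi c d x).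
Proof. by move=> [xd xd']; exact: local_rep_overlap. Qed.

Let fE x : U x -> local_rep chi c d' x = transition d d' (local_rep chi c d x).
Proof. by move=> [xd _]; exact: local_rep_target. Qed.

Lemma coord_tension_target x :
  local_dom chi c d x -> local_dom chi c d' x ->
  coord_tension chi c d' x =
  coord_tension chi c d x *m jac (transition d d') (local_rep chi c d x).
Proof.
move=> xd xd'.
have E := tension_target (metric M c) oU (@overlap_open _ _ _ d d') (@overlap_open _ _ _ d' d)
  (metric_on_overlap d d') (metric_on_overlap d' d) (transition_isometry d d')
  sf UV fE (conj xd xd').
exact: E.
Qed.

Lemma coord_dens_target de x : natural_density de ->
  local_dom chi c d x -> local_dom chi c d' x ->
  coord_dens de chi c d' x = coord_dens de chi c d x.
Proof.
move=> nde xd xd'.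
exact: (density_target nde oU (@overlap_open _ _ _ d d') (@overlap_open _ _ _ d' d) mU
  (metric_on_overlap _ _) (metric_on_overlap _ _) (transition_isometry d d')
  sf UV fE (conj xd xd')).
Qed.

End TargetChart.

Section SourceChart.
Context chi chi' (O : set M) c c' d.
Hypotheses (schi : smooth_map chi) (schi' : smooth_map chi') (oO : open O)
  (chiE : forall p, O p -> chi p = chi' p).
Let U := overlap c c' `&` (local_dom chi c d `&`
  (cod (chart_of M c) `&` param (chart_of M c) @^-1` O)).
Let U' := overlap c' c `&` local_dom chi' c' d.

Let oU : open U.
Proof.
apply: openI; first exact: overlap_open.
apply: openI; first by apply: local_dom_open; case: schi.
by apply: open_preimage_in; [exact: cod_open|exact: param_continuous|].
Qed.

Let oU' : open U'.
Proof.
by apply: openI; [exact: overlap_open|apply: local_dom_open; case: schi'].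
Qed.

Let iso : isometry_on U U' (metric M c) (metric M c') (transition c c').
Proof.
apply: (isometry_on_sub _ _ (transition_isometry c c')) => [x []//|x].
move=> [xcc [[_ xd] [_ xO]]]; split; first exact: overlap_transition.
have [c'x _] := overlap_transition xcc; split => //.
rewrite /preimage /= /transition /= coordK; last by case: xcc.
by rewrite -chiE.
Qed.

Let mU : metric_on U (metric M c).
Proof. by apply: metric_on_sub (metric_on_chart c) => x [[]]. Qed.

Let mU' : metric_on U' (metric M c').
Proof. by apply: metric_on_sub (metric_on_chart c') => x [[]]. Qed.

Let sf' : smooth_mx U' (local_rep chi' c' d).
Proof.
have [_ /(_ c' d)/smooth_onP] := schi'; apply: smooth_mx_sub; exact: subIsetr.
Qed.

Let U'V x : U' x -> cod (chart_of N d) (local_rep chi' c' d x).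
Proof. by move=> [_ xd]; exact: local_rep_cod. Qed.

Let fE x : U x -> local_rep chi c d x = local_rep chi' c' d (transition c c' x).
Proof.
move=> [xcc [_ [_ xO]]]; rewrite /local_rep /transition /= coordK.
  by rewrite chiE.
by case: xcc.
Qed.

Let Ux x : overlap c c' x -> local_dom chi c d x ->
  O (param (chart_of M c) x) -> U x.
Proof. by move=> xcc xd xO; do 2![split => //]; case: xcc. Qed.

Lemma coord_tension_source x : overlap c c' x -> local_dom chi c d x ->
  O (param (chart_of M c) x) ->
  coord_tension chi c d x = coord_tension chi' c' d (transition c c' x).
Proof.
move=> xcc xd xO.
exact: (tension_source _ oU oU' mU mU' iso sf' fE (Ux xcc xd xO)).
Qed.

Lemma coord_dens_source de x : natural_density de ->
  overlap c c' x -> local_dom chi c d x -> O (param (chart_of M c) x) ->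
  coord_dens de chi c d x = coord_dens de chi' c' d (transition c c' x).
Proof.
move=> nde xcc xd xO.
exact: (density_source nde oU oU' (@cod_open _ _ _ _) mU mU' iso
  (metric_on_chart d) sf' U'V fE (Ux xcc xd xO)).
Qed.

End SourceChart.

Lemma coord_overlap c c' p : dom (chart_of M c) p -> dom (chart_of M c') p ->
  overlap c c' (coord (chart_of M c) p).
Proof.
move=> cp c'p; split; first exact: coord_cod.
by rewrite /preimage /= coordK.
Qed.

Lemma coord_local_dom chi c d p : dom (chart_of M c) p ->
  dom (chart_of N d) (chi p) -> local_dom chi c d (coord (chart_of M c) p).
Proof.
move=> cp dp; split; first exact: coord_cod.
by rewrite /preimage /= coordK.
Qed.

Lemma transition_coord c c' p : dom (chart_of M c) p ->
  transition c c' (coord (chart_of M c) p) = coord (chart_of M c') p.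
Proof. by move=> cp; rewrite /transition /= coordK. Qed.

(** Allowing two maps which agree near [p] gives locality together with
    independence of the charts. *)
Lemma coord_dens_invariant de chi chi' (O : set M) c c' d d' p :
  natural_density de -> smooth_map chi -> smooth_map chi' ->
  open O -> (forall q, O q -> chi q = chi' q) -> O p ->
  dom (chart_of M c) p -> dom (chart_of M c') p ->
  dom (chart_of N d) (chi p) -> dom (chart_of N d') (chi p) ->
  coord_dens de chi c d (coord (chart_of M c) p) =
  coord_dens de chi' c' d' (coord (chart_of M c') p).
Proof.
move=> nde schi schi' oO chiE Op cp c'p dp d'p.
have dp' : dom (chart_of N d') (chi' p) by rewrite -chiE.
rewrite -(coord_dens_target schi nde (coord_local_dom cp dp) (coord_local_dom cp d'p)).
rewrite (coord_dens_source schi schi' oO chiE nde (coord_overlap cp c'p)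
  (coord_local_dom cp d'p)) ?coordK //.
by rewrite transition_coord.
Qed.

Definition dens de chi (p : M) : R :=
  coord_dens de chi (chart_at M p) (chart_at N (chi p))
    (coord (chart_of M (chart_at M p)) p).

Lemma ES_densityE chi p : smooth_map chi ->
  ES_density chi p = dens (fun q => @curvature_density R q m n) chi p.
Proof.
move=> schi; rewrite /ES_density /dens /coord_dens /curvature_density.
set c := chart_at M p; set d := chart_at N (chi p).
set U := local_dom chi c d; set x := coord _ p.
have oU : open U by apply: local_dom_open; case: schi.
have Ux : U x by apply: coord_local_dom; exact: mem_chart_at.
have mU : metric_on U (metric M c).
  by apply: metric_on_sub (metric_on_chart c) => y [].
have sf : smooth_mx U (local_rep chi c d).
  by have [_ /(_ c d)/smooth_onP] := schi.
have sid : smooth_mx U id.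
  by move=> a b k; rewrite [a]ord1; exact: Ck_coord.
have UV y : U y -> cod (chart_of N d) (local_rep chi c d y).
  exact: local_rep_cod.
have stau := smooth_family_tension id oU oU (@cod_open _ _ _ _) mU
  (metric_on_chart d) sid (fun y Uy => Uy) sf UV.
have KE i j := curv_commutator oU (@cod_open _ _ _ _) (metric_on_chart d) sf UV
  stau i j Ux.
apply: eq_trg => i k; apply: eq_trg => j l.
congr (inner _ _ _); [exact: (KE i j)|exact: (KE k l)].
Qed.

(** The charts may be kept fixed while [p] and [chi] vary. *)
Lemma dens_chart de chi c d p : natural_density de -> smooth_map chi ->
  dom (chart_of M c) p -> dom (chart_of N d) (chi p) ->
  dens de chi p = coord_dens de chi c d (coord (chart_of M c) p).
Proof.
move=> nde schi cp dp.
by apply: (coord_dens_invariant nde schi schi openT (fun q _ => erefl) I);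
  rewrite ?mem_chart_at //; exact: mem_chart_at.
Qed.

Lemma dens_local de chi chi' (O : set M) p : natural_density de ->
  smooth_map chi -> smooth_map chi' -> open O ->
  (forall q, O q -> chi q = chi' q) -> O p -> dens de chi p = dens de chi' p.
Proof.
move=> nde schi schi' oO chiE Op.
by apply: (coord_dens_invariant nde schi schi' oO chiE Op) => //;
  rewrite ?chiE //; exact: mem_chart_at.
Qed.

Lemma dens_ge0 de chi p : natural_density de -> smooth_map chi ->
  0 <= dens de chi p.
Proof.
move=> nde schi.
have cp := mem_chart_at p; have dp := mem_chart_at (chi p).
have xd := coord_local_dom cp dp.
exact: (density_ge0 nde (metric_on_chart _) (metric_on_chart _)
  (coord_cod cp) (local_rep_cod xd)).
Qed.

(** Harmonicity speaks of one chart at each point; the tension field vanishes in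
    all charts because it transforms as a vector. *)
Lemma harmonic_tension chi c d x : smooth_map chi -> harmonic_map chi ->
  local_dom chi c d x -> coord_tension chi c d x = 0.
Proof.
move=> schi hchi xd; set p := param (chart_of M c) x.
set c0 := chart_at M p; set d0 := chart_at N (chi p).
have [cx dx] := xd.
have cp : dom (chart_of M c) p by exact: param_dom.
have c0p := mem_chart_at p; have d0p := mem_chart_at (chi p).
have xE : x = coord (chart_of M c) p by rewrite /p paramK.
rewrite xE (coord_tension_source (c' := c0) schi schi openT (fun q _ => erefl)
  (coord_overlap cp c0p) (coord_local_dom cp dx)) // transition_coord //.
rewrite (coord_tension_target schi (coord_local_dom c0p d0p) (coord_local_dom c0p dx)).
have -> : coord_tension chi c0 d0 (coord (chart_of M c0) p) = 0 by exact: hchi.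
by rewrite mul0mx.
Qed.

Lemma dens_harmonic de chi p : natural_density de -> smooth_map chi ->
  harmonic_map chi -> dens de chi p = 0.
Proof.
move=> nde schi hchi.
have xd := coord_local_dom (mem_chart_at p) (mem_chart_at (chi p)).
apply: (density_eq0 nde _ _ xd); first by apply: local_dom_open; case: schi.
by move=> y yd; exact: harmonic_tension.
Qed.

End Maps.

(** * Smooth dependence on time *)

Section ContinuityOfPairs.

Lemma continuous_pair (S T U : topologicalType) (f : S -> T) (g : S -> U) x :
  {for x, continuous f} -> {for x, continuous g} ->
  {for x, continuous (fun y => (f y, g y))}.
Proof. by move=> cf cg; exact: (cvg_pair cf cg). Qed.

Lemma continuous_pairl (T U : topologicalType) (u : U) (x : T) :
  {for x, continuous (fun y : T => (y, u))}.
Proof. by apply: continuous_pair; [move=> A; exact|exact: cst_continuous]. Qed.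

Lemma continuous_pairr (T U : topologicalType) (t : T) (x : U) :
  {for x, continuous (fun y : U => (t, y))}.
Proof. by apply: continuous_pair; [exact: cst_continuous|move=> A; exact]. Qed.

End ContinuityOfPairs.

Section SpaceTime.
Context {R : realType} (m : nat).

Definition slice (t : R) (x : 'rV[R]_m) : 'rV[R]_(1 + m) :=
  row_mx (const_mx t) x.

Lemma lsubmx_slice t x : lsubmx (slice t x) 0 0 = t.
Proof. by rewrite row_mxKl mxE. Qed.

Lemma rsubmx_slice t x : rsubmx (slice t x) = x.
Proof. exact: row_mxKr. Qed.

Lemma slice_line_space (t h : R) (i : 'I_m) x :
  slice t (h *: delta_mx 0 i + x) = h *: delta_mx 0 (rshift 1 i) + slice t x.
Proof.
apply/rowP => k; rewrite !mxE eqxx /=; case: (split_ordP k) => j ->.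
  by rewrite eq_lrshift mulr0 add0r.
by rewrite eq_rshift !mxE eqxx.
Qed.

Lemma slice_line_time (t h : R) x :
  slice (h + t) x = h *: delta_mx 0 (lshift m 0) + slice t x.
Proof.
apply/rowP => k; rewrite !mxE eqxx /=; case: (split_ordP k) => j ->.
  by rewrite eq_lshift [j]ord1 !mxE eqxx mulr1.
by rewrite eq_rlshift mulr0 add0r.
Qed.

Lemma smooth_slice (U : set 'rV[R]_m) t : smooth_mx U (slice t).
Proof.
move=> a k; rewrite [a]ord1; case: (split_ordP k) => j ->.
  have -> : (fun x => slice t x 0 (lshift m j)) = fun=> t.
    by apply/funext => x; rewrite row_mxEl mxE.
  exact: smooth_cst.
have -> : (fun x => slice t x 0 (rshift 1 j)) = fun x => x 0 j.
  by apply/funext => x; rewrite row_mxEr.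
by move=> l; exact: Ck_coord.
Qed.

Lemma smooth_rsubmx (W : set 'rV[R]_(1 + m)) : smooth_mx W rsubmx.
Proof.
move=> a k; rewrite [a]ord1.
have -> : (fun z : 'rV[R]_(1 + m) => rsubmx z 0 k) = fun z => z 0 (rshift 1 k).
  by apply/funext => z; rewrite mxE.
by move=> l; exact: Ck_coord.
Qed.

Lemma smooth_mx_continuous q (W : set 'rV[R]_q) p (A : 'rV[R]_q -> 'rV[R]_p) x :
  smooth_mx W A -> W x -> {for x, continuous A}.
Proof.
by move=> sA Wx; apply: continuous_row => a; exact: Ck_continuous (sA 0 a 0%N) Wx.
Qed.

Lemma time_continuous : continuous (fun z : 'rV[R]_(1 + m) => lsubmx z 0 0 : R).
Proof.
have -> : (fun z : 'rV[R]_(1 + m) => lsubmx z 0 0 : R) =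
          (fun z => z 0 (lshift m 0)).
  by apply/funext => z; rewrite mxE.
exact: coord_continuous.
Qed.

Lemma space_continuous : continuous (fun z : 'rV[R]_(1 + m) => rsubmx z).
Proof. by move=> z; exact: (smooth_mx_continuous (@smooth_rsubmx setT)). Qed.

Lemma derive_time (g : 'rV[R]_(1 + m) -> R) x t :
  derivable g (slice t x) (delta_mx 0 (lshift m 0)) ->
  is_derive t (1 : R) (fun s => g (slice s x)) (pd (lshift m 0) g (slice t x)).
Proof.
rewrite /pd /derivable /derive => dg.
set g2 := (fun h : R => _) in dg *.
suff E : (fun h : R => h^-1 *: (((fun s => g (slice s x)) \o shift t) (h *: (1 : R))
    - g (slice t x))) = g2.
  by apply: DeriveDef; rewrite /derivable /derive E.
apply/funext => h; rewrite /g2 /= -slice_line_time.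
by rewrite [h%:A]mulr1.
Qed.

End SpaceTime.

Section SmoothFamilies.
Context {R : realType} (m : nat) (M : manifold R m).

(** Near each time and position, [D] is in some chart of M a smooth function on
    an open set [W] of space-time; the same chart and the same [W] serve for all
    derivatives, which makes the notion stable under d/dt. *)
Definition smooth_family (e : R) (D : R -> M -> R) : Prop :=
  forall (t : R) (p : M), `|t| < e -> exists c : chart_index M,
    dom (chart_of M c) p /\
    exists W g, [/\ open W, W (slice t (coord (chart_of M c) p)), smooth W g &
      forall t' p', dom (chart_of M c) p' -> W (slice t' (coord (chart_of M c) p')) ->
        D t' p' = g (slice t' (coord (chart_of M c) p'))].

Variables (e : R) (D : R -> M -> R).
Hypothesis sD : smooth_family e D.

Lemma slice_coord_continuous c t p : dom (chart_of M c) p ->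
  {for (t, p), continuous
    (fun q : R * M => slice q.1 (coord (chart_of M c) q.2))}.
Proof.
move=> cp; apply: continuous_row => k; case: (split_ordP k) => j ->.
  have -> : (fun q : R * M => slice q.1 (coord (chart_of M c) q.2) 0 (lshift m j))
      = fst by apply/funext => q; rewrite row_mxEl mxE.
  exact: cvg_fst.
have -> : (fun q : R * M => slice q.1 (coord (chart_of M c) q.2) 0 (rshift 1 j))
    = (fun x : 'rV[R]_m => x 0 j) \o (coord (chart_of M c) \o snd).
  by apply/funext => q; rewrite row_mxEr.
apply: continuous_comp; last exact: coord_continuous.
by apply: continuous_comp; [exact: cvg_snd|exact: Defs.coord_continuous].
Qed.

Lemma smooth_family_continuous t p : `|t| < e ->
  {for (t, p), continuous (fun q : R * M => D q.1 q.2)}.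
Proof.
move=> /(sD p)[c [cp [W [g [oW Wtp sg DE]]]]].
have cs := @slice_coord_continuous c t p cp.
have cg : {for (t, p), continuous
    (fun q : R * M => g (slice q.1 (coord (chart_of M c) q.2)))}.
  by apply: continuous_comp; [exact: cs|exact: Ck_continuous (sg 0%N) Wtp].
apply: continuous_near_eq cg.
have near_dom : \forall q \near (t, p), dom (chart_of M c) q.2.
  by apply: (@cvg_snd _ _ (nbhs t) (nbhs p)); apply: near_open cp; exact: dom_open.
have near_W : \forall q \near (t, p), W (slice q.1 (coord (chart_of M c) q.2)).
  exact: (cs _ (near_open oW Wtp)).
by apply: filterS2 near_dom near_W => -[s q] /= cq Wq; rewrite DE.
Qed.

Lemma smooth_family_near t p : `|t| < e -> exists c W g,
  [/\ dom (chart_of M c) p, open W, W (slice t (coord (chart_of M c) p)),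
      smooth W g &
      forall t' p', dom (chart_of M c) p' -> W (slice t' (coord (chart_of M c) p')) ->
        D t' p' = g (slice t' (coord (chart_of M c) p')) /\
        is_derive t' (1 : R) (D ^~ p')
          (pd (lshift m 0) g (slice t' (coord (chart_of M c) p')))].
Proof.
move=> /(sD p)[c [cp [W [g [oW Wtp sg DE]]]]].
exists c, W, g; split => // t' p' cp' Wtp'; split; first exact: DE.
have dg := derive_time (smooth_derivable (i := lshift m 0) sg Wtp').
apply: near_eq_is_derive dg.
have cs : {for t', continuous (fun s => slice s (coord (chart_of M c) p'))}.
  have cs' := @slice_coord_continuous c t' p' cp'.
  apply: (@continuous_comp _ _ _ (fun s : R => (s, p'))
    (fun q : R * M => slice q.1 (coord (chart_of M c) q.2)) t' _ cs').
  exact: continuous_pairl.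
have : \forall s \near t', W (slice s (coord (chart_of M c) p')).
  exact: (cs _ (near_open oW Wtp')).
by apply: filterS => s Ws; rewrite DE.
Qed.

Lemma smooth_family_derivable t p : `|t| < e -> derivable (D ^~ p) t 1.
Proof.
move=> /(smooth_family_near p)[c [W [g [cp _ Wtp _ /(_ t p cp Wtp)[_ []]]]]].
by [].
Qed.

Lemma smooth_family_derive : smooth_family e (fun t p => 'D_1 (D ^~ p) t).
Proof.
move=> t p /(smooth_family_near p)[c [W [g [cp oW Wtp sg DE]]]].
exists c; split => //; exists W, (pd (lshift m 0) g); split => //.
  exact: smooth_pd.
by move=> t' p' cp' Wtp'; have [_ []] := DE t' p' cp' Wtp'.
Qed.

End SmoothFamilies.

Section Variations.
Context {R : realType} (m n : nat) (M : riemannian R m) (N : riemannian R n).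
Variables (phi : M -> N) (e : R) (Phi : R -> M -> N).
Hypothesis varPhi : is_variation phi e Phi.

Let W (c : chart_index M) (d : chart_index N) : set 'rV[R]_(1 + m) :=
  [set z | `|lsubmx z 0 0| < e /\ local_dom (Phi (lsubmx z 0 0)) c d (rsubmx z)].

Let Phit (c : chart_index M) (d : chart_index N) (z : 'rV[R]_(1 + m)) :=
  local_rep (Phi (lsubmx z 0 0)) c d (rsubmx z).

Lemma variation_dom_open c d : open (W c d).
Proof.
pose U1 : set 'rV[R]_(1 + m) := setT `&` (fun z => lsubmx z 0 0) @^-1` [set t : R | `|t| < e].
have oU1 : open U1.
  apply: open_preimage_in; [exact: openT| |].
    by move=> z _; exact: time_continuous.
  by have := @open_comp _ _ (fun t : R => `|t|) [set t | t < e] (fun t _ => @norm_continuous _ R t) (@open_lt R e).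
pose U2 : set 'rV[R]_(1 + m) := U1 `&` (fun z => rsubmx z) @^-1` cod (chart_of M c).
have oU2 : open U2.
  exact: (open_preimage_in oU1 (fun z _ => @space_continuous R m z)
    (@cod_open _ _ _ (chart_of M c))).
suff -> : W c d = U2 `&` (fun z => Phi (lsubmx z 0 0) (param (chart_of M c) (rsubmx z)))
   @^-1` dom (chart_of N d).
  apply: (open_preimage_in oU2 _ (@dom_open _ _ _ (chart_of N d))).
  move=> z [[_ zt] zc].
  apply: (@continuous_comp _ _ _
    (fun z => (lsubmx z 0 0, param (chart_of M c) (rsubmx z)))
    (fun q : R * M => Phi q.1 q.2)); last exact: (variation_continuous varPhi).
  apply: continuous_pair; first exact: time_continuous.
  by apply: continuous_comp; [exact: space_continuous|exact: param_continuous].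
apply/seteqP; split => z; first by move=> [zt [zc zd]].
by move=> [[[_ zt] zc] zd].
Qed.

Lemma smooth_Phit c d : smooth_mx (W c d) (Phit c d).
Proof. by apply/smooth_onP; exact: (variation_smooth varPhi c d). Qed.

Lemma variation_smooth_map t : `|t| < e -> smooth_map (Phi t).
Proof.
move=> te; split.
  move=> p; apply: (@continuous_comp _ _ _ (fun q : M => (t, q))
    (fun q : R * M => Phi q.1 q.2)); last exact: (variation_continuous varPhi).
  exact: continuous_pairr.
move=> c d; apply/smooth_onP.
have oU : open (local_dom (Phi t) c d).
  apply: local_dom_open => p; apply: (@continuous_comp _ _ _ (fun q : M => (t, q))
    (fun q : R * M => Phi q.1 q.2)); last exact: (variation_continuous varPhi).
  exact: continuous_pairr.
have UW x : local_dom (Phi t) c d x -> W c d (slice t x).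
  by move=> xd; rewrite /W /= lsubmx_slice rsubmx_slice.
have := smooth_mx_comp oU (@variation_dom_open c d) (smooth_Phit c d)
  (@smooth_slice _ _ _ t) UW.
by apply: smooth_mx_eq => // x _; rewrite /Phit lsubmx_slice rsubmx_slice.
Qed.

(** The charts at [(t, p)] serve for all nearby times and points, and there the
    density is the coordinate expression on space-time. *)
Lemma smooth_family_dens de : natural_density de ->
  smooth_family e (fun t p => dens de (Phi t) p).
Proof.
move=> nde t p te; set c := chart_at M p; set d := chart_at N (Phi t p).
exists c; split; first exact: mem_chart_at.
exists (W c d), (de _ (@rshift 1 m) rsubmx (metric M c) (metric N d) (Phit c d)).
have oW := @variation_dom_open c d.
split => //.
- rewrite /W /= lsubmx_slice rsubmx_slice; split => //.
  by apply: coord_local_dom; exact: mem_chart_at.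
- apply: (density_smooth nde (@rshift 1 m) oW (@cod_open _ _ _ (chart_of M c))
    (@cod_open _ _ _ (chart_of N d)) (metric_on_chart c) (metric_on_chart d)
    (@smooth_rsubmx _ _ _) _ (smooth_Phit c d)) => z [_ zd]; first by case: zd.
  exact: local_rep_cod zd.
move=> t' p' cp'; rewrite /W /= lsubmx_slice rsubmx_slice => -[te' xd].
have dp' : dom (chart_of N d) (Phi t' p').
  by case: xd => _; rewrite /preimage /= coordK.
rewrite (dens_chart nde (variation_smooth_map te') cp' dp') /coord_dens.
have sliceE := density_slice nde (metric M c) (metric N d) (Phit c d)
  (@rsubmx_slice R m t') (@slice_line_space R m t') (coord (chart_of M c) p').
rewrite -sliceE; congr (de _ _ _ _ _ _ _); apply/funext => x.
by rewrite /Phit lsubmx_slice rsubmx_slice.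
Qed.

End Variations.

(** * Volume of compact sets *)

Section BorelMeasures.
Context {R : realType}.

Lemma open_borel_measurable (T : ptopologicalType) (A : set (borel T)) :
  open (A : set T) -> measurable A.
Proof. by move=> oA; exact: sub_sigma_algebra. Qed.

Lemma continuous_borel_measurable (T : ptopologicalType) (A : set T) (f : T -> R) :
  open A -> (forall x, A x -> {for x, continuous f}) ->
  measurable_fun (A : set (borel T)) (f : borel T -> R).
Proof.
move=> oA cf; apply: (measurability _ (RGenOpens.measurableE R)).
move=> _ [_ [a [b ->] <-]]; apply: open_borel_measurable.
by apply: open_preimage_in => //; exact: interval_open.
Qed.

End BorelMeasures.

Section VolumeOfCompacts.
Context {R : realType} (m : nat) (M : riemannian R m)
  (vol : {measure set (borel M) -> \bar R}).
Hypothesis volP : is_volume vol.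

Definition box (x : 'rV[R]_m) (r : R) : set 'rV[R]_m :=
  [set y | forall i, (x - const_mx r) 0 i < y 0 i < (x + const_mx r) 0 i].

Lemma box_open x r : open (box x r).
Proof.
rewrite openE => y yb.
have ci i : {for y, continuous (fun z : 'rV[R]_m => z 0 i)} by exact: coord_continuous.
have lo i : \forall z \near (y : 'rV[R]_m), (x - const_mx r) 0 i < (z : 'rV[R]_m) 0 i.
  by apply: (cvgr_gt _ (ci i)); have /andP[] := yb i.
have hi i : \forall z \near (y : 'rV[R]_m), (z : 'rV[R]_m) 0 i < (x + const_mx r) 0 i.
  by apply: (cvgr_lt _ (ci i)); have /andP[] := yb i.
near=> z => i; apply/andP; split; move: i; near: z; exact: filter_forall.
Unshelve. all: by end_near. Qed.

Lemma box_center x r : 0 < r -> box x r x.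
Proof. by move=> r0 i; rewrite !mxE ltrBlDr !ltrDl r0. Qed.

Lemma box_dist x r y : 0 < r -> box x r y -> `|x - y| <= r.
Proof.
move=> r0 yb; apply: norm_row_le => [|i]; first exact: ltW.
have := yb i; rewrite !mxE => /andP[y1 y2].
by rewrite ler_norml; apply/andP; split; lra.
Qed.

(** On a small box in a chart the volume density is bounded and Lebesgue measure
    is finite. *)
Lemma local_finite_volume (p : M) :
  exists O : set M, [/\ open O, O p & (vol O < +oo)%E].
Proof.
have [lam lamP volE] := volP.
set c := chart_at M p; have cp : dom (chart_of M c) p := mem_chart_at p.
pose J x : R := Num.sqrt (\det (metric M c x)).
set x0 := coord (chart_of M c) p.
have cx0 : cod (chart_of M c) x0 by exact: coord_cod.
have [sG _ _] := metric_on_chart c.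
have cJ x : cod (chart_of M c) x -> {for x, continuous J}.
  move=> cx; apply: (@continuous_comp _ _ _ (fun x => \det (metric M c x))).
    exact: Ck_continuous (smooth_det (@cod_open _ _ _ _) sG 0%N) cx.
  exact: sqrt_continuous.
have : \forall x \near x0, cod (chart_of M c) x /\ J x < J x0 + 1.
  have near1 := near_open (@cod_open _ _ _ (chart_of M c)) cx0.
  have near2 : \forall x \near x0, J x < J x0 + 1.
    by apply: (cvgr_lt (J x0) (cJ x0 cx0)); rewrite ltrDl.
  exact: filterS2 (fun x a b => conj a b) near1 near2.
move=> /nbhs_normP[r /= r0 rP].
pose B := box x0 (r / 2); have r20 : 0 < r / 2 by rewrite divr_gt0.
have BP x : B x -> cod (chart_of M c) x /\ J x < J x0 + 1.
  move=> xB; apply: rP => /=; apply: (le_lt_trans (box_dist r20 xB)).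
  by rewrite ltr_pdivrMr // ltr_pMr // ltr1n.
pose O : set M := dom (chart_of M c) `&` coord (chart_of M c) @^-1` B.
have oO : open O.
  apply: open_preimage_in; [exact: dom_open|exact: Defs.coord_continuous|exact: box_open].
exists O; split => //; first by split => //; exact: box_center.
have coordO : coord (chart_of M c) @` O = B.
  apply/seteqP; split => [_ [q [_ qB] <-] //|x xB].
  have [cx _] := BP x xB.
  exists (param (chart_of M c) x); last exact: paramK.
  by split; [exact: param_dom|rewrite /preimage /= paramK].
rewrite (volE c O) //; [|exact: open_borel_measurable|by move=> q []].
rewrite coordO -/(J _).
have mB : measurable (B : set (borel 'rV[R]_m)).
  by apply: open_borel_measurable; exact: box_open.
have mJ : measurable_fun (B : set (borel 'rV[R]_m)) (J : borel 'rV[R]_m -> R).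
  apply: continuous_borel_measurable; first exact: box_open.
  by move=> x /BP[cx _]; exact: cJ.
have J0 x : 0 <= J x by exact: sqrtr_ge0.
have -> : (\int[lam]_(x in B) (J x)%:E = \int[lam]_(x in B) `|(J x)%:E|)%E.
  by apply: eq_integral => x _; rewrite gee0_abs // lee_fin.
apply: (le_lt_trans (@integral_le_bound _ _ _ lam B (EFin \o J) (J x0 + 1)%:E mB _ _ _)).
- exact/measurable_EFinP.
- by rewrite lee_fin addr_ge0.
- by apply: aeW => x /BP[_ Jx]; rewrite /= lee_fin ger0_norm // ltW.
rewrite (lamP (x0 - const_mx (r / 2)) (x0 + const_mx (r / 2))) -?EFinM ?ltry //.
by move=> i; rewrite !mxE; lra.
Qed.

Lemma compact_finite_volume (K : set M) : compact K -> (vol K < +oo)%E.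
Proof.
move=> cK.
have /choice[V VP] := local_finite_volume.
have mK : measurable (K : set (borel M)).
  rewrite -(setCK K); apply: measurableC; apply: open_borel_measurable.
  by apply: closed_openC; exact: compact_closed (@manifold_hausdorff _ _ _) cK.
move: (cK); rewrite compact_cover => /(_ M setT V)[|p _|D' _ KD'].
- by move=> p _; have [] := VP p.
- by exists p => //; have [] := VP p.
have sO (s : seq M) : open (\big[setU/set0]_(i <- s) V i) /\
    (vol (\big[setU/set0]_(i <- s) V i) < +oo)%E.
  elim: s => [|p s [os vs]]; first by rewrite big_nil measure0; split; [exact: open0|].
  have [op _ vp] := VP p.
  rewrite big_cons; split; first exact: openU.
  apply: (le_lt_trans (measureU2 _ _ _)); try exact: open_borel_measurable.
  exact: lte_add_pinfty.
have [oD vD] := sO (finmap.enum_fset D').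
apply: le_lt_trans vD; apply: le_measure; rewrite ?inE //.
  exact: open_borel_measurable.
by move: KD'; rewrite /cover bigcup_fset.
Qed.

End VolumeOfCompacts.

(** * Differentiation of integrals and minima *)

Section TwiceDerivable.
Context {R : realType}.

(** Exactly the regularity needed for a second derivative at 0. *)
Definition twice_derivable (e : R) (F : R -> R) : Prop :=
  (forall t : R, `|t| < e -> derivable F t 1) /\
  derivable (fun t => 'D_1 F t) 0 1.

Lemma near_norm_lt (e t : R) : `|t| < e -> \forall s \near t, `|s| < e.
Proof.
move=> te.
have ct : {for t, continuous (fun s : R => `|s|)} by exact: norm_continuous.
exact: (cvgr_lt _ ct _ te).
Qed.

Lemma twice_derivable_eq (e : R) (F G : R -> R) :
  0 < e -> (forall t, `|t| < e -> F t = G t) ->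
  twice_derivable e F -> twice_derivable e G.
Proof.
move=> e0 FG [dF ddF].
have nFG t : `|t| < e -> \forall s \near t, F s = G s.
  by move=> te; apply: filterS (near_norm_lt te) => s /FG.
split; first by move=> t te; exact: near_eq_derivable (nFG t te) (dF t te).
apply: near_eq_derivable ddF.
have : \forall t \near (0 : R), `|t| < e by apply: near_norm_lt; rewrite normr0.
by apply: filterS => t te; exact: near_eq_derive (nFG t te).
Qed.

Lemma twice_derivable_add (e : R) (F G : R -> R) :
  0 < e -> twice_derivable e F -> twice_derivable e G ->
  twice_derivable e (fun t => F t + G t).
Proof.
move=> e0 [dF ddF] [dG ddG].
split; first by move=> t te; exact: (derivableD (dF t te) (dG t te)).
apply: near_eq_derivable (derivableD ddF ddG).
have : \forall t \near (0 : R), `|t| < e by apply: near_norm_lt; rewrite normr0.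
by apply: filterS => t te; rewrite [RHS](deriveD (dF t te) (dG t te)).
Qed.

Lemma twice_derivable_scale (e k : R) (F : R -> R) :
  0 < e -> twice_derivable e F -> twice_derivable e (fun t => k * F t).
Proof.
move=> e0 [dF ddF].
have dZ (G : R -> R) t : derivable G t 1 -> derivable (fun t => k * G t) t 1.
  by move=> dG; have := @derivableM _ _ (cst k) G t 1 (derivable_cst _ _ _) dG; exact.
split; first by move=> t /dF/dZ.
apply: near_eq_derivable (dZ _ _ ddF).
have : \forall t \near (0 : R), `|t| < e by apply: near_norm_lt; rewrite normr0.
by apply: filterS => t te; rewrite [RHS](deriveMl k (dF t te)).
Qed.

Section Minimum.
Variables (e : R) (F : R -> R).
Hypotheses (e0 : 0 < e) (dF : twice_derivable e F)
  (F_ge0 : forall t, `|t| < e -> 0 <= F t) (F0 : F 0 = 0).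

Let normE (t : R) : (`|t| < e) = (t \in `]- e, e[).
Proof. by rewrite in_itv /= ltr_norml. Qed.

Lemma derive_at_minimum : is_derive (0 : R) (1 : R) F 0.
Proof.
have [dF1 _] := dF.
apply: (@derive1_at_min _ F (- e) e 0).
- by move: e0; lra.
- by move=> t; rewrite -normE; exact: dF1.
- by rewrite -normE normr0.
- by move=> t; rewrite -normE F0; exact: F_ge0.
Qed.

(** If the second derivative were negative, the first derivative would be negative
    just after 0 and [F] would take negative values. *)
Lemma second_derivative_at_minimum :
  exists2 q : R, is_second_derivative F q & 0 <= q.
Proof.
have [dF1 dF2] := dF.
set q := 'D_(1 : R) (fun t => 'D_1 F t) (0 : R).
exists q.
  split; last exact: derivableP.
  have : \forall t \near (0 : R), `|t| < e by apply: near_norm_lt; rewrite normr0.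
  by apply: filterS => t; exact: dF1.
rewrite leNgt; apply/negP => q0.
have D0 : 'D_1 F 0 = 0 by rewrite (@derive_val _ _ _ _ _ _ _ derive_at_minimum).
have : h^-1 *: ('D_1 F (h *: (1 : R) + 0) - 'D_1 F 0) @[h --> 0^'] --> q.
  exact: dF2.
move=> /cvgr_lt/(_ 0 q0); rewrite near_withinE.
move=> /nbhs_normP[d /= d0 dP].
pose h := Num.min (d / 2) (e / 2).
have h0 : 0 < h by rewrite lt_min !divr_gt0.
have hd : h < d by rewrite gt_min; apply/orP; left; rewrite ltr_pdivrMr // ltr_pMr // ltr1n.
have he : h < e by rewrite gt_min; apply/orP; right; rewrite ltr_pdivrMr // ltr_pMr // ltr1n.
have dFh s : s \in `]0, h[%R -> is_derive s 1 F ('D_1 F s).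
  rewrite in_itv /= => /andP[s0 sh]; apply/derivableP/dF1.
  by rewrite gtr0_norm // (lt_trans sh).
have [|s sI FE] := MVT h0 dFh.
  apply: derivable_within_continuous => s; rewrite in_itv /= => /andP[s0 sh].
  by apply: dF1; rewrite ger0_norm // (le_lt_trans sh).
move: sI; rewrite in_itv /= => /andP[s0 sh].
have Ds : 'D_1 F s < 0.
  have := dP s; rewrite /= sub0r normrN gtr0_norm // (lt_trans sh hd) => /(_ isT).
  rewrite gt_eqF // => /(_ isT); rewrite D0 subr0 addr0 [s%:A]mulr1.
  by rewrite /GRing.scale /= pmulr_rlt0 // invr_gt0.
have FhE : F h = 'D_1 F s * h by have := FE; rewrite F0 !subr0.
have : F h < 0 by rewrite FhE nmulr_rlt0.
by rewrite ltNge F_ge0 // gtr0_norm.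
Qed.

End Minimum.
End TwiceDerivable.

Section IntegralOfFamily.
Context {R : realType} (m : nat) (M : manifold R m)
  (vol : {measure set (borel M) -> \bar R}) (K : set M) (e : R).
Hypotheses (cK : compact K) (volK : (vol K < +oo)%E).

Let mK : measurable (K : set (borel M)).
Proof.
rewrite -(setCK K); apply: measurableC; apply: open_borel_measurable.
by apply: closed_openC; exact: compact_closed (@manifold_hausdorff _ _ _) cK.
Qed.

Lemma smooth_family_bounded D (e' : R) : smooth_family e D -> e' < e ->
  exists C : R, forall t p, `|t| <= e' -> K p -> `|D t p| <= C.
Proof.
move=> sD e'e; pose A : set (R * M) := `[- e', e']%classic `*` K.
have cA : compact A by apply: compact_setX => //; exact: segment_compact.
have cf : {within A, continuous (fun q : R * M => D q.1 q.2)}.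
  apply: continuous_in_subspaceT => -[t p]; rewrite inE => -[/= tI pK].
  have te : `|t| < e.
    by move: tI; rewrite in_itv /= -ler_norml => /le_lt_trans; apply.
  exact: (@smooth_family_continuous _ _ _ _ _ sD t p te).
have [B [_ BP]] := compact_bounded (continuous_compact cf cA).
exists (B + 1) => t p te pK; apply: (BP (B + 1)); first by rewrite ltrDl.
by exists (t, p) => //; split => //=; rewrite in_itv /= -ler_norml.
Qed.

Lemma smooth_family_measurable D t : smooth_family e D -> `|t| < e ->
  measurable_fun (K : set (borel M)) (D t : borel M -> R).
Proof.
move=> sD te; apply: (@measurable_funS _ _ _ _ setT) => //.
apply: (continuous_borel_measurable (openT : open [set: M])) => p _.
apply: (@continuous_comp _ _ _ (fun q : M => (t, q)) (fun q : R * M => D q.1 q.2)).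
  exact: continuous_pairr.
exact: (@smooth_family_continuous _ _ _ _ _ sD t p te).
Qed.

Lemma smooth_family_integrable D t : smooth_family e D -> `|t| < e ->
  vol.-integrable K (EFin \o D t).
Proof.
move=> sD te; apply: measurable_bounded_integrable => //.
  exact: smooth_family_measurable.
have [C CP] := smooth_family_bounded sD te.
exists C; split; first exact: num_real.
by move=> x Cx p Kp; apply: le_trans (ltW Cx); exact: CP.
Qed.

(** Dominated convergence on a slightly smaller time interval; the dominating
    function is a constant, integrable because [K] has finite volume. *)
Lemma derive_integral_family D t : smooth_family e D -> `|t| < e ->
  is_derive t (1 : R) (fun s => \int[vol]_(p in K) D s p)
    (\int[vol]_(p in K) 'D_1 (D ^~ p) t).
Proof.
move=> sD te; pose e' := (`|t| + e) / 2.
have te' : `|t| < e' by rewrite /e'; lra.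
have e'e : e' < e by rewrite /e'; lra.
have [C CP] := smooth_family_bounded (smooth_family_derive sD) e'e.
have I_e s : `]- e', e'[%classic s -> `|s| < e.
  by rewrite /= in_itv /= -ltr_norml => /lt_trans; apply.
have It : `]- e', e'[%classic t by rewrite /= in_itv /= -ltr_norml.
have intf s : `]- e', e'[%classic s -> vol.-integrable K (EFin \o D s).
  by move=> /I_e; exact: smooth_family_integrable.
have derf s p : `]- e', e'[%classic s -> K p -> derivable (D ^~ p) s 1.
  by move=> /I_e se _; exact: (@smooth_family_derivable _ _ _ _ _ sD s p se).
have G0 (p : borel M) : 0 <= (cst `|C| : borel M -> R) p by [].
have intG : vol.-integrable K (EFin \o (cst `|C| : borel M -> R)).
  apply: measurable_bounded_integrable => //.
  exists `|C|; split; first exact: num_real.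
  by move=> x Cx p Kp; rewrite /= normr_id ltW.
have Gub s p : `]- e', e'[%classic s -> K p ->
    `|partial1of2 D s p| <= (cst `|C| : borel M -> R) p.
  rewrite /= in_itv /= -ltr_norml => se' Kp; rewrite partial1of2E.
  by apply: le_trans (ler_norm C); apply: CP => //; exact: ltW.
apply: DeriveDef.
  exact: (derivable_under_integral mK It intf derf G0 intG Gub).
rewrite -derive1E (differentiation_under_integral mK It intf derf G0 intG Gub).
by apply: eq_Rintegral => p _; rewrite partial1of2E.
Qed.

Lemma twice_derivable_integral D : 0 < e -> smooth_family e D ->
  twice_derivable e (fun s => \int[vol]_(p in K) D s p).
Proof.
move=> e0 sD; split; first by move=> t /(derive_integral_family sD)[].
have e00 : `|0 : R| < e by rewrite normr0.
have [dD _] := derive_integral_family (smooth_family_derive sD) e00.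
apply: near_eq_derivable dD.
have : \forall t \near (0 : R), `|t| < e by apply: near_norm_lt; rewrite normr0.
by apply: filterS => t /(derive_integral_family sD)[_ ->].
Qed.

End IntegralOfFamily.

(** * Stability *)

Section Stability.
Context {R : realType} (m n : nat) (M : riemannian R m) (N : riemannian R n)
  (phi : M -> N).

(** Implies both criticality and weak stability, and passes to sums and
    nonnegative multiples, so that the two terms of E4ES can be treated apart. *)
Definition minimal_along_variations (F : (M -> N) -> \bar R) : Prop :=
  forall (e : R) (Phi : R -> M -> N), is_variation phi e Phi ->
  exists G : R -> R, [/\ twice_derivable e G, G 0 = 0 &
    forall t, `|t| < e -> 0 <= G t /\ F (Phi t) = (G t)%:E].

Lemma minimal_stable F : minimal_along_variations F ->
  critical_point F phi /\ weakly_stable F phi.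
Proof.
move=> minF.
suff H (e : R) (Phi : R -> M -> N) : is_variation phi e Phi ->
  [/\ \forall t \near (0 : R), F (Phi t) \is a fin_num,
      is_derive (0 : R) (1 : R) (functional_along F Phi) (0 : R) &
      exists2 q : R, is_second_derivative (functional_along F Phi) q & 0 <= q].
  split; first by move=> e Phi /H[].
  by move=> V _ _ e Phi /H[].
move=> varPhi; have [G [dG G0 GP]] := minF e Phi varPhi.
have e0 := variation_pos varPhi.
have near_e : \forall t \near (0 : R), `|t| < e by apply: near_norm_lt; rewrite normr0.
have GE t : `|t| < e -> G t = functional_along F Phi t.
  by move=> /GP[_ FE]; rewrite /functional_along FE.
have dF := twice_derivable_eq e0 GE dG.
have F_ge0 t : `|t| < e -> 0 <= functional_along F Phi t.
  by move=> te; rewrite -GE //; have [] := GP t te.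
have F0 : functional_along F Phi 0 = 0 by rewrite -GE ?normr0.
split; last exact: (second_derivative_at_minimum e0 dF F_ge0 F0).
  by apply: filterS near_e => t /GP[_ ->].
exact: (derive_at_minimum e0 dF F_ge0 F0).
Qed.

Lemma minimal_scale (k : R) F : 0 <= k -> minimal_along_variations F ->
  minimal_along_variations (fun chi => (k%:E * F chi)%E).
Proof.
move=> k0 minF e Phi varPhi; have [G [dG G0 GP]] := minF e Phi varPhi.
exists (fun t => k * G t); split.
- exact: twice_derivable_scale (variation_pos varPhi) dG.
- by rewrite G0 mulr0.
- by move=> t /GP[Gt ->]; rewrite mulr_ge0 // EFinM.
Qed.

Lemma minimal_add F1 F2 : minimal_along_variations F1 ->
  minimal_along_variations F2 ->
  minimal_along_variations (fun chi => (F1 chi + F2 chi)%E).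
Proof.
move=> min1 min2 e Phi varPhi.
have [G1 [dG1 G10 G1P]] := min1 e Phi varPhi.
have [G2 [dG2 G20 G2P]] := min2 e Phi varPhi.
exists (fun t => G1 t + G2 t); split.
- exact: twice_derivable_add (variation_pos varPhi) dG1 dG2.
- by rewrite G10 G20 addr0.
- by move=> t te; have [p1 ->] := G1P t te; have [p2 ->] := G2P t te;
    rewrite addr_ge0 // EFinD.
Qed.

Lemma minimal_eq F1 F2 : (forall chi, smooth_map chi -> F1 chi = F2 chi) ->
  minimal_along_variations F1 -> minimal_along_variations F2.
Proof.
move=> FE min1 e Phi varPhi; have [G [dG G0 GP]] := min1 e Phi varPhi.
exists G; split => // t te; rewrite -FE; first exact: GP.
exact: (variation_smooth_map varPhi).
Qed.

Hypotheses (phi_smooth : smooth_map phi) (phi_harmonic : harmonic_map phi).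

(** Outside the support of the variation the density vanishes, so the integral
    is over a compact set. *)
Lemma minimal_density_integral (vol : {measure set (borel M) -> \bar R}) de :
  is_volume vol -> natural_density de ->
  minimal_along_variations (fun chi => (\int[vol]_p (dens de chi p)%:E)%E).
Proof.
move=> volP nde e Phi varPhi; have e0 := variation_pos varPhi.
have [K cK KP] := variation_support varPhi.
have volK := compact_finite_volume volP cK.
have oK : open (~` K).
  by apply: closed_openC; exact: compact_closed (@manifold_hausdorff _ _ _) cK.
have sD := smooth_family_dens varPhi nde.
have sPhi t : `|t| < e -> smooth_map (Phi t) by exact: (variation_smooth_map varPhi).
have D0 t p : `|t| < e -> ~ K p -> dens de (Phi t) p = 0.
  move=> te Kp.
  rewrite (dens_local nde (sPhi t te) phi_smooth oK (fun q Kq => KP t q te Kq) Kp).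
  exact: dens_harmonic.
exists (fun t => \int[vol]_(p in K) dens de (Phi t) p); split.
- exact: twice_derivable_integral.
- rewrite /Rintegral (eq_integral (cst 0%E)) ?integral0 // => p _.
  by rewrite (variation_0 varPhi) dens_harmonic.
move=> t te; split.
  by apply: Rintegral_ge0 => p _; apply: dens_ge0 => //; exact: sPhi.
have intD := smooth_family_integrable cK volK sD te.
rewrite /Rintegral fineK; last first.
  apply: integrable_fin_num intD.
  rewrite -(setCK K); apply: measurableC; exact: open_borel_measurable.
rewrite [RHS]integral_mkcond; congr integral; apply/funext => p.
rewrite /patch; case: ifPn => // /negP; rewrite inE => Kp.
by rewrite D0.
Qed.

End Stability.

Theorem theorem4p8 (R : realType) (m n : nat) (M : riemannian R m)
    (N : riemannian R n) (vol : {measure set (borel M) -> \bar R})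
    (volP : is_volume vol) (phi : M -> N) (phi_smooth : smooth_map phi)
    (phi_harmonic : harmonic_map phi) :
  (critical_point (@E4 R m n M N vol) phi /\
   weakly_stable (@E4 R m n M N vol) phi) /\
  (critical_point (@E4ES R m n M N vol) phi /\
   weakly_stable (@E4ES R m n M N vol) phi).
Proof.
have min4 : minimal_along_variations phi (@E4 R m n M N vol).
  apply: minimal_scale; first by rewrite invr_ge0.
  (* The integrand of E4 unfolds to bienergy_density. *)
  exact: (minimal_density_integral phi_smooth phi_harmonic volP
    (natural_bienergy_density R m n)).
split; first exact: minimal_stable.
apply: minimal_stable; apply: minimal_add => //.
apply: minimal_scale; first by rewrite invr_ge0.
apply: minimal_eq (minimal_density_integral phi_smooth phi_harmonic volP
    (natural_curvature_density R m n)) => chi schi.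
by apply: eq_integral => p _; rewrite ES_densityE.
Qed.
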